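(* Fix the dimension $n$. For $\lambda=(\lambda_1,\ldots,\lambda_n)$ with $\lambda_1\ge\cdots\ge\lambda_n>0$ let $A=\mathrm{diag}(\lambda)$ and $\mathrm{cond}(A)=\lambda_1/\lambda_n$, and let $\mathrm{AveROC}(\lambda)$ and $\mathrm{WorstROC}(\lambda)=\frac{1-a}{1+a}$, $a=\mathrm{cond}(A)^{-1}$, denote the average and the worst case rate of convergence of the exact line search gradient descent method applied to $f(x)=\frac12 x^TAx$. (i) Let $n\ge 2$. As $\lambda$ ranges over those vectors for which $A$ has exactly two distinct eigenvalues, $\mathrm{AveROC}(\lambda)\to 0$ when $\mathrm{cond}(A)\to\infty$. (ii) Let $n\ge 3$ and let $\eta\in(0,1/2)$ be fixed. As $\lambda$ ranges over those vectors for which there is an index $i\in\{2,\ldots,n-1\}$ with $\lambda_n+\eta(\lambda_1-\lambda_n)\le\lambda_i\le\lambda_1-\eta(\lambda_1-\lambda_n)$ and $\lambda_1>\lambda_n$ (an intermediate eigenvalue uniformly bounded away from the two extremal eigenvalues), one has $\mathrm{WorstROC}(\lambda)-\mathrm{AveROC}(\lambda)\to 0$ and $\mathrm{WorstROC}(\lambda)\to 1$ when $\mathrm{cond}(A)\to\infty$.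
   Context: Let $A=\mathrm{diag}(\lambda)$, $\lambda=(\lambda_1,\ldots,\lambda_n)$, $\lambda_1\ge\cdots\ge\lambda_n>0$. The exact line search gradient descent method for $f(x)=\frac12x^TAx$ is the iteration $x^{(k+1)}=\mathsf{OGD}(x^{(k)})$, where $\mathsf{OGD}(x)=x-\frac{x^TA^2x}{x^TA^3x}Ax$ for $x\ne0$ and $\mathsf{OGD}(0)=0$. The one-step shrinking factor is, for $x\neq 0$, $$\rho(x,\lambda)=\sqrt{1-\frac{(x^TA^2x)^2}{(x^TAx)(x^TA^3x)}},$$ with the convention $\rho(0,\lambda)=0$. It satisfies $\|\mathsf{OGD}(x)\|_A=\rho(x,\lambda)\|x\|_A$, where $\|x\|_A=\sqrt{x^TAx}$. For $x^{(0)}\ne0$ the rate of convergence (ROC) is $$\rho^\ast(x^{(0)},\lambda)=\limsup_{k\to\infty}\Big[\prod_{j=0}^{k-1}\rho(\mathsf{OGD}^j(x^{(0)}),\lambda)\Big]^{1/k}.$$ The average ROC is $\mathrm{AveROC}(\lambda)=\int_{\mathbb S^{n-1}}\rho^\ast(x,\lambda)\,d\mu(x)$, where $\mu$ is the uniform probability measure on the unit sphere $\mathbb S^{n-1}\subset\mathbb R^n$. The worst case ROC is $\max_{x\in\mathbb S^{n-1}}\rho^\ast(x,\lambda)$, which equals $\frac{1-a}{1+a}$ with $a=\lambda_n/\lambda_1$. *)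

(* Defs.v *)
From HB Require Import structures.
From mathcomp Require Import all_boot all_order all_algebra.
From mathcomp Require Import all_classical all_reals all_analysis.
From mathcomp Require Import measurable_realfun.

Set Implicit Arguments.
Unset Strict Implicit.
Unset Printing Implicit Defensive.

Import Order.TTheory GRing.Theory Num.Theory.
Import numFieldNormedType.Exports.

Local Open Scope classical_set_scope.
Local Open Scope ring_scope.

Section Dynamics.
Variables (R : realType) (n : nat).
Implicit Types (A : 'M[R]_n) (lam : 'rV[R]_n) (x : 'cV[R]_n).

Definition qform A x : R := (x^T *m A *m x) 0 0.

Definition OGD lam x : 'cV[R]_n :=
  let A := diag_mx lam in
  if x == 0 then 0
  else x - (qform (A ^+ 2) x / qform (A ^+ 3) x) *: (A *m x).

Definition rho lam x : R :=
  let A := diag_mx lam in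
  if x == 0 then 0
  else Num.sqrt (1 - qform (A ^+ 2) x ^+ 2 / (qform A x * qform (A ^+ 3) x)).

(* The sequence takes values in [0, 1], so the real-valued [limn_sup] is the
   limsup; the junk term [k = 0] is irrelevant to it. *)
Definition ROC lam x : R :=
  limn_sup (fun k : nat =>
    (\prod_(j < k) rho lam (iter j (OGD lam) x)) `^ (k%:R^-1)).

Definition sphere : set 'cV[R]_n := [set x | qform 1%:M x = 1].

Definition worstROC lam : R := sup [set ROC lam x | x in sphere].

End Dynamics.

(* The library has no Lebesgue measure on R^n: it is built here on
   [n.-tuple (measurableTypeR R)], whose sigma-algebra is the product Borel one,
   by iterating the binary product measure; [lebesgue_tuple_box] gives the
   expected value on boxes. *)
Section LebesgueTuple.
Variable R : realType.
Local Open Scope ereal_scope.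
Notation TR := (measurableTypeR R).

Definition tcons n (p : TR * n.-tuple TR) : n.+1.-tuple TR :=
  [tuple of p.1 :: p.2].

Definition tuncons n (t : n.+1.-tuple TR) : TR * n.-tuple TR :=
  (thead t, [tuple of behead t]).

Lemma tconsK n : cancel (@tcons n) (@tuncons n).
Proof.
by move=> [x t]; rewrite /tuncons /tcons /=; congr pair; apply: val_inj.
Qed.

Lemma tunconsK n : cancel (@tuncons n) (@tcons n).
Proof. by move=> t; rewrite /tcons /tuncons /= [RHS]tuple_eta; exact: val_inj. Qed.

Lemma measurable_tcons n : measurable_fun setT (@tcons n).
Proof. by apply: measurable_cons; [exact: measurable_fst|exact: measurable_snd]. Qed.

Lemma measurable_tuncons n : measurable_fun setT (@tuncons n).
Proof.
apply/measurable_fun_pairP; split.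
- exact: measurable_tnth.
- exact: measurable_behead.
Qed.

Section Cons.
Variables (n : nat) (m : {sigma_finite_measure set (n.-tuple TR) -> \bar R}).

Definition lebesgue_cons : set (n.+1.-tuple TR) -> \bar R :=
  pushforward (@lebesgue_measure R \x m) (@tcons n).

Let mcons : measurable_fun setT (@tcons n) := @measurable_tcons n.

Let cons0 : lebesgue_cons set0 = 0.
Proof. exact: measure0. Qed.

Let cons_ge0 A : 0 <= lebesgue_cons A.
Proof. exact: measure_ge0. Qed.

Let cons_sigma_additive : semi_sigma_additive lebesgue_cons.
Proof. exact: measure_semi_sigma_additive. Qed.

HB.instance Definition _ := isMeasure.Build _ _ _ lebesgue_cons
  cons0 cons_ge0 cons_sigma_additive.

Let cons_sigma_finite : sigma_finite setT lebesgue_cons.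
Proof.
have /sigma_finiteP[F [UF ndF mF]] := sigma_finiteT (@lebesgue_measure R).
have /sigma_finiteP[G [UG ndG mG]] := sigma_finiteT m.
exists (fun k => @tuncons n @^-1` (F k `*` G k)).
  rewrite -preimage_bigcup; apply/seteqP; split => // t _ /=.
  have [i _ Fi] : (\bigcup_i F i) (tuncons t).1 by rewrite -UF.
  have [j _ Gj] : (\bigcup_i G i) (tuncons t).2 by rewrite -UG.
  exists (maxn i j) => //; split.
  - by move: Fi; apply/subsetPset/ndF/leq_maxl.
  - by move: Gj; apply/subsetPset/ndG/leq_maxr.
move=> k; have [mFk Fkoo] := mF k; have [mGk Gkoo] := mG k; split.
  rewrite -[X in measurable X]setTI; apply: measurable_tuncons => //.
  exact: measurableX.
rewrite /lebesgue_cons /pushforward -comp_preimage (_ : _ \o _ = id); last first.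
  by apply/funext => p /=; rewrite tconsK.
by rewrite preimage_id product_measure1E // lte_mul_pinfty // ge0_fin_numE.
Qed.

HB.instance Definition _ :=
  Measure_isSigmaFinite.Build _ _ _ lebesgue_cons cons_sigma_finite.

End Cons.

Fixpoint lebesgue_tuple n : {sigma_finite_measure set (n.-tuple TR) -> \bar R} :=
  if n is n'.+1 then lebesgue_cons (lebesgue_tuple n')
  else \d_([tuple] : 0.-tuple TR).

Definition tbox n (A : 'I_n -> set TR) : set (n.-tuple TR) :=
  [set t | forall i, A i (tnth t i)].

Lemma measurable_tbox n (A : 'I_n -> set TR) :
  (forall i, measurable (A i)) -> measurable (tbox A).
Proof.
move=> mA; rewrite (_ : tbox A = \bigcap_(i in [set: 'I_n]) (fun t => tnth t i) @^-1` A i).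
  apply: fin_bigcap_measurable => // i _.
  by rewrite -[X in measurable X]setTI; exact: measurable_tnth.
by apply/seteqP; split => t /= tA; [move=> i _; exact: tA | move=> i; exact: tA].
Qed.

Lemma lebesgue_tuple_box n (A : 'I_n -> set TR) :
  (forall i, measurable (A i)) ->
  lebesgue_tuple n (tbox A) = \prod_(i < n) lebesgue_measure (A i).
Proof.
elim: n A => [A _|n IH A mA].
  rewrite big_ord0 /= diracE mem_set // => i; by case: i.
rewrite big_ord_recl -(IH (fun i => A (lift ord0 i))) //=.
rewrite /lebesgue_cons /pushforward -product_measure1E //; last exact: measurable_tbox.
congr (_ _); apply/seteqP; split => -[x t] /=.
  move=> xtA; split; first exact: (xtA ord0).
  by move=> i; have := xtA (lift ord0 i); rewrite tnthS.
move=> [Ax At] i; case: (unliftP ord0 i) => [j|] ->; last exact: Ax.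
rewrite tnthS; exact: At.
Qed.

End LebesgueTuple.

Section UniformSphere.
Variables (R : realType) (n : nat).
Notation TR := (measurableTypeR R).

Definition cvec (t : n.-tuple TR) : 'cV[R]_n := \col_i (tnth t i : R).

Definition tnorm (t : n.-tuple TR) : R := Num.sqrt (qform 1%:M (cvec t)).

Definition tball : set (n.-tuple TR) := [set t | tnorm t <= 1].

Definition tnormalize (t : n.-tuple TR) : n.-tuple TR :=
  [tuple (tnth t i : R) / tnorm t | i < n].

Lemma qform1E (t : n.-tuple TR) :
  qform 1%:M (cvec t) = \sum_(i < n) (tnth t i : R) ^+ 2.
Proof.
rewrite /qform mulmx1 mxE; apply: eq_bigr => i _.
by rewrite !mxE expr2.
Qed.

Lemma measurable_tnorm : measurable_fun setT (tnorm : n.-tuple TR -> R).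
Proof.
rewrite (_ : tnorm = (@Num.sqrt R) \o (fun t => \sum_(i < n) (tnth t i : R) ^+ 2)).
  apply: measurableT_comp.
    by apply: continuous_measurable_fun; exact: sqrt_continuous.
  apply: measurable_sum => i; apply: measurable_funX; exact: measurable_tnth.
by apply/funext => t /=; rewrite /tnorm qform1E.
Qed.

Lemma measurable_tball : measurable tball.
Proof.
rewrite (_ : tball = tnorm @^-1` `]-oo, 1]); last first.
  by apply/seteqP; split => t; rewrite /= in_itv.
rewrite -[X in measurable X]setTI; exact: measurable_tnorm.
Qed.

Lemma measurable_tnormalize : measurable_fun setT tnormalize.
Proof.
apply/measurable_fun_tnthP => i.
rewrite (_ : _ \o _ = fun t => (tnth t i : R) * (tnorm t `^ (-1))); last first.
  by apply/funext => t /=; rewrite tnth_mktuple powR_inv1 // sqrtr_ge0.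
apply: measurable_funM; first exact: measurable_tnth.
apply: (measurableT_comp (measurable_powR (-1))); exact: measurable_tnorm.
Qed.

Lemma lebesgue_tball_gt0 : (0 < lebesgue_tuple R n tball)%E.
Proof.
pose r : R := n.+1%:R^-1.
have r0 : 0 < r by rewrite invr_gt0.
apply: (@lt_le_trans _ _ (lebesgue_tuple R n (tbox (fun=> `[0, r]%classic)))).
  rewrite lebesgue_tuple_box; last by move=> i; exact: measurable_itv.
  elim/big_ind : _ => //= [x y|i _]; first exact: mule_gt0.
  by rewrite lebesgue_measure_itv /= lte_fin r0 oppr0 adde0 lte_fin.
apply: le_measure; rewrite ?inE //.
- by apply: measurable_tbox => i; exact: measurable_itv.
- exact: measurable_tball.
move=> t tr; rewrite /tball /= -[leRHS]sqrtr1 ler_wsqrtr // qform1E.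
apply: (@le_trans _ _ (\sum_(i < n) r)).
  apply: ler_sum => i _; have := tr i; rewrite /= in_itv /= => /andP[t0 tr'].
  rewrite expr2 -[leRHS]mul1r ler_pM // (le_trans tr') //.
  by rewrite invf_le1 // ler1n.
rewrite sumr_const card_ord -mulr_natl ler_pdivrMr // mul1r ler_nat.
exact: leqnSn.
Qed.

Lemma lebesgue_tball_lty : (lebesgue_tuple R n tball < +oo)%E.
Proof.
apply: (@le_lt_trans _ _ (lebesgue_tuple R n (tbox (fun=> `[-1, 1]%classic)))).
  apply: le_measure; rewrite ?inE //.
  - exact: measurable_tball.
  - by apply: measurable_tbox => i; exact: measurable_itv.
  move=> t tr i; rewrite /= in_itv /= -ler_norml -sqrtr_sqr.
  apply: le_trans tr; rewrite ler_wsqrtr // qform1E (bigD1 i) //= lerDl.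
  by apply: sumr_ge0 => j _; exact: sqr_ge0.
rewrite lebesgue_tuple_box; last by move=> i; exact: measurable_itv.
rewrite (eq_bigr (fun=> (1 - -1 : R)%:E)); first by rewrite prodEFin ltry.
by move=> i _; rewrite /= lebesgue_measure_itv /= lte_fin gtrN.
Qed.

(* [mnormalize] asks for a default probability, only used when the total mass
   is [0] or [+oo]; by [lebesgue_tball_gt0] and [lebesgue_tball_lty] this never
   happens and the Dirac mass plays no role. *)
Definition uniform_ball : probability (n.-tuple TR) R :=
  mnormalize (mrestr (lebesgue_tuple R n) measurable_tball)
    \d_([tuple 0 | _ < n] : n.-tuple TR).

(* Uniform probability on the unit sphere as the normalized cone measure
   [B |-> vol {s x | x in B, 0 <= s <= 1} / vol (unit ball)], that is, the image
   of the uniform law of the unit ball under [x |-> x / |x|]. As a measure on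
   R^n it is carried by the sphere, see [uniform_sphere_sphere]. *)
Definition uniform_sphere := pushforward uniform_ball tnormalize.

Let mnormalize_ := measurable_tnormalize.

Let uniform_sphere0 : uniform_sphere set0 = 0%E.
Proof. exact: measure0. Qed.

Let uniform_sphere_ge0 A : (0 <= uniform_sphere A)%E.
Proof. exact: measure_ge0. Qed.

Let uniform_sphere_sigma_additive : semi_sigma_additive uniform_sphere.
Proof. exact: measure_semi_sigma_additive. Qed.

HB.instance Definition _ := isMeasure.Build _ _ _ uniform_sphere
  uniform_sphere0 uniform_sphere_ge0 uniform_sphere_sigma_additive.

Let uniform_sphereT : uniform_sphere setT = 1%E.
Proof. by rewrite /uniform_sphere /pushforward preimage_setT probability_setT. Qed.

HB.instance Definition _ :=
  Measure_isProbability.Build _ _ _ uniform_sphere uniform_sphereT.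

Lemma uniform_sphereE (B : set (n.-tuple TR)) :
  uniform_sphere B =
  (lebesgue_tuple R n (tnormalize @^-1` B `&` tball)
   * (fine (lebesgue_tuple R n tball))^-1%:E)%E.
Proof.
rewrite /uniform_sphere /pushforward /uniform_ball /= /mnormalize /=.
rewrite /mrestr setTI; case: ifPn => // /orP[] /eqP h.
- by have := lebesgue_tball_gt0; rewrite h ltxx.
- by have := lebesgue_tball_lty; rewrite h ltxx.
Qed.

Lemma uniform_sphere_sphere :
  (0 < n)%N -> uniform_sphere (cvec @^-1` @sphere R n) = 1%E.
Proof.
move=> n0.
have mS : measurable (cvec @^-1` @sphere R n).
  rewrite (_ : _ @^-1` _ = tnorm @^-1` [set 1]).
    by rewrite -[X in measurable X]setTI; apply: measurable_tnorm.
  apply/seteqP; split => t; rewrite /sphere /tnorm /=.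
    by move=> ->; rewrite sqrtr1.
  move=> /(congr1 (fun x => x ^+ 2)); rewrite sqr_sqrtr ?expr1n //.
  by rewrite qform1E; apply: sumr_ge0 => i _; exact: sqr_ge0.
pose Z : set (n.-tuple TR) := tbox (fun=> [set 0]).
have mZ : measurable Z by apply: measurable_tbox => i; exact: measurable_set1.
have Z0 : lebesgue_tuple R n Z = 0%E.
  rewrite lebesgue_tuple_box; last by move=> i; exact: measurable_set1.
  by rewrite (bigD1 (Ordinal n0)) //= lebesgue_measure_set1 mul0e.
have CS0 : uniform_sphere (~` (cvec @^-1` @sphere R n)) = 0%E.
  rewrite uniform_sphereE (@subset_measure0 _ _ _ (lebesgue_tuple R n) _ Z) ?mul0e //.
    apply: measurableI; last exact: measurable_tball.
    rewrite -[X in measurable X]setTI; apply: measurable_tnormalize => //.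
    exact: measurableC.
  move=> t [/= tS _]; apply: contrapT => tZ; apply: tS.
  have t0 : 0 < qform 1%:M (cvec t).
    rewrite qform1E lt_neqAle sumr_ge0 ?andbT; last by move=> i _; exact: sqr_ge0.
    apply/eqP => /esym/eqP; rewrite psumr_eq0; last by move=> i _; exact: sqr_ge0.
    move=> /allP h; apply: tZ => i /=.
    by have := h i (mem_index_enum i); rewrite /= sqrf_eq0 => /eqP.
  rewrite /sphere /= qform1E.
  under eq_bigr do rewrite tnth_mktuple expr_div_n sqr_sqrtr ?ltW //.
  by rewrite -mulr_suml -qform1E divff // gt_eqF.
have := @probability_setC _ _ _ uniform_sphere _ (measurableC mS).
by rewrite setCK => ->; rewrite [X in (1 - X)%E]CS0 sube0.
Qed.

Definition aveROC (lam : 'rV[R]_n) : R :=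
  \int[uniform_sphere]_(t in cvec @^-1` @sphere R n) ROC lam (cvec t).

End UniformSphere.

(* Vectors [lambda_1 >= ... >= lambda_n > 0]; the dimension is [n.+1] and
   [lambda_1], [lambda_n] are the entries at [ord0], [ord_max]. *)
Definition spectrum_vec (R : realType) n (lam : 'rV[R]_n.+1) : Prop :=
  (forall i j : 'I_n.+1, (i <= j)%N -> lam 0 j <= lam 0 i) /\
  0 < lam 0 ord_max.

Definition cond (R : realType) n (lam : 'rV[R]_n.+1) : R :=
  lam 0 ord0 / lam 0 ord_max.

Definition two_eigenvalues (R : realType) n (lam : 'rV[R]_n.+1) : Prop :=
  exists a b : R, a != b /\ eigenvalue (diag_mx lam) =1 pred2 a b.

Definition intermediate (R : realType) n (eta : R) (lam : 'rV[R]_n.+1) : Prop :=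
  let l1 := lam 0 ord0 in let ln := lam 0 ord_max in
  ln < l1 /\
  exists i : 'I_n.+1, [/\ (0 < i < n)%N,
    ln + eta * (l1 - ln) <= lam 0 i & lam 0 i <= l1 - eta * (l1 - ln)].

(* [F lam --> l] as [cond lam --> +oo], [lam] ranging over the admissible
   vectors that satisfy [P]. *)
Definition cvg_cond (R : realType) n (P : 'rV[R]_n.+1 -> Prop)
    (F : 'rV[R]_n.+1 -> R) (l : R) : Prop :=
  forall eps : R, 0 < eps -> exists M : R,
    forall lam : 'rV[R]_n.+1, spectrum_vec lam -> P lam ->
      M <= cond lam -> `|F lam - l| < eps.

(* Main.v *)
Require Import Defs.
From mathcomp Require Import all_boot all_order all_algebra.
From mathcomp Require Import all_classical all_reals all_analysis.
From mathcomp Require Import measurable_realfun.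
From mathcomp Require Import ring lra zify.

(** Write x_k for the iterates, L and l for the extreme eigenvalues, and let
p_k be the weights lambda_i^2 x_{k,i}^2 normalized to sum 1, that is, the
distribution of the squared gradient over the spectrum. With m and V the mean
and the variance of lambda under p, one step of exact line search multiplies
the i-th coordinate of x by 1 - lambda_i / m and turns p into
[reweight p] : i |-> p_i (lambda_i - m)^2 / V ([OGD_wmean], [weight_OGD]).

Worst case. Kantorovich's inequality bounds every factor [rho] by
(L - l) / (L + l) ([rho_le_kantorovich]); a vector carried by the two extreme
coordinates with equal gradient entries there attains the bound at every step
([ROC_balanced]).

Two eigenvalues. If u and v are the squared gradient norms in the two
eigenspaces, a step maps (u, v) to a multiple of (u v^2, v u^2), so the ratio
u / v is only inverted. Any bound K u v <= u^2 + v^2 therefore persists, and it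
yields ROC(x)^2 <= 1 / (cond x_1^2) on the sphere ([ROC_two_eigenvalues]).
Averaging, the set where x_1 is small has small measure.

An intermediate eigenvalue lambda_i. Since the coordinate of lambda_n is
multiplied by 1 - l / m at each step, the ROC is close to 1 as soon as m stays
away from l, and m - l >= V / (L - l). So it is enough that V is eventually at
least a fixed fraction of (L - l)^2 ([wvar_eventually_ge]). Let Q be the monic
quadratic polynomial orthogonal to 1 and lambda under p ([orthopoly]), and let
E_i = p_i p'_i V, where p' is the reweighting of p ([energy]). One step never
decreases V, and it multiplies E_i by ((Q(lambda_i) + V) / V)^2, while E_i <= V
stays bounded.
- Q is nonnegative at L and at l. So E does not decrease there, and since it
  stays bounded, Q tends to 0 at both ends. Being monic of degree 2, Q then
  tends to - (L - lambda_i) (lambda_i - l) at lambda_i.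
- If V stayed below a bound less than half of (L - lambda_i) (lambda_i - l),
  then E_i, unless it vanishes, would eventually grow geometrically.
Hence a starting point can be bad only if one of its two extreme coordinates
is 0 or its i-th coordinate vanishes at some step. Multiplied by a common
denominator the iteration is polynomial ([polyGD]), so these points lie in
countably many zero sets of nonzero polynomials, each of measure 0 by Fubini
([polyfun_zeros_null]). *)

Set Implicit Arguments.
Unset Strict Implicit.
Unset Printing Implicit Defensive.

Import Order.TTheory GRing.Theory Num.Theory.
Import numFieldNormedType.Exports.

Local Open Scope classical_set_scope.
Local Open Scope ring_scope.

(** * Weights on the spectrum and their reweighting *)

Section Distribution.
Variables (R : realFieldType) (I : finType) (lam : I -> R).
Implicit Types p : I -> R.

Definition wmean p : R := \sum_i p i * lam i.

Definition wvar p : R := \sum_i p i * (lam i - wmean p) ^+ 2.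

(** One step of gradient descent, seen on the normalized squared gradient. *)
Definition reweight p : I -> R := fun i => p i * (lam i - wmean p) ^+ 2 / wvar p.

(** The monic polynomial of degree 2 orthogonal to 1 and lambda for the weights
p. Centred at the mean, it is t^2 - (mu3 / V) t - V; as mu3 / V is the shift of
the mean under reweighting, the roots of Q + V are the two means. *)
Definition orthopoly p (t : R) : R :=
  (t - wmean p) * (t - wmean (reweight p)) - wvar p.

(** Multiplying the weights of two consecutive steps avoids treating the even
and the odd steps separately: the dynamics tends to a cycle of length 2. *)
Definition energy p i : R := p i * reweight p i * wvar p.

Definition prob_weights p := (forall i, 0 <= p i) /\ \sum_i p i = 1.

Lemma sum_center p : \sum_i p i = 1 -> \sum_i p i * (lam i - wmean p) = 0.
Proof.
move=> p1; under eq_bigr do rewrite mulrBr.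
by rewrite sumrB -mulr_suml p1 mul1r subrr.
Qed.

Lemma sum_reweight p : wvar p != 0 -> \sum_i reweight p i = 1.
Proof. by move=> v0; rewrite /reweight -mulr_suml divff. Qed.

Lemma wvar_ge0 p : prob_weights p -> 0 <= wvar p.
Proof.
by move=> [p0 _]; apply: sumr_ge0 => i _; rewrite mulr_ge0 ?sqr_ge0.
Qed.

Lemma reweight_prob_weights p : prob_weights p -> wvar p != 0 ->
  prob_weights (reweight p).
Proof.
move=> dp v0; split; last exact: sum_reweight.
move=> i; apply: divr_ge0; last exact: wvar_ge0.
by rewrite mulr_ge0 ?sqr_ge0 ?dp.1.
Qed.

Lemma prob_weights_le1 p i : prob_weights p -> p i <= 1.
Proof.
by move=> [p0 <-]; rewrite (bigD1 i) //= lerDl sumr_ge0.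
Qed.

Lemma third_moment p : \sum_i p i = 1 -> wvar p != 0 ->
  \sum_i p i * (lam i - wmean p) ^+ 3 =
  (wmean (reweight p) - wmean p) * wvar p.
Proof.
move=> p1 v0.
have -> : wmean (reweight p) - wmean p = \sum_i reweight p i * (lam i - wmean p).
  under eq_bigr do rewrite mulrBr.
  by rewrite sumrB -mulr_suml sum_reweight // mul1r.
rewrite mulr_suml; apply: eq_bigr => i _; rewrite /reweight.
by field.
Qed.

Lemma orthopoly_wmean0 p : \sum_i p i = 1 ->
  \sum_i p i * orthopoly p (lam i) = 0.
Proof.
move=> p1; have c0 := sum_center p1.
transitivity (\sum_i (p i * (lam i - wmean p) ^+ 2
    + (p i * (lam i - wmean p)) * (wmean p - wmean (reweight p))
    - p i * wvar p)).
  by apply: eq_bigr => i _; rewrite /orthopoly; ring.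
by rewrite sumrB big_split /= -!mulr_suml c0 p1; rewrite /wvar; ring.
Qed.

(** The increase of the variance is the squared distance of lambda^2 to the
span of 1 and lambda, divided by the variance. *)
Lemma wvar_reweight p : \sum_i p i = 1 -> wvar p != 0 ->
  wvar (reweight p) =
  wvar p + (\sum_i p i * orthopoly p (lam i) ^+ 2) / wvar p.
Proof.
move=> p1 v0; have q0 := orthopoly_wmean0 p1.
rewrite {1}/wvar.
transitivity (\sum_i (p i * orthopoly p (lam i) ^+ 2 / wvar p
   + (p i * orthopoly p (lam i)) * 2 + p i * wvar p)).
  apply: eq_bigr => i _; rewrite /orthopoly {1}/reweight.
  by move: (wmean _) (wmean _) => a b; field.
by rewrite !big_split /= -!mulr_suml p1 q0; ring.
Qed.

Lemma le_wvar_reweight p : prob_weights p -> wvar p != 0 ->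
  wvar p <= wvar (reweight p).
Proof.
move=> dp v0; rewrite wvar_reweight ?dp.2 // lerDl divr_ge0 ?wvar_ge0 //.
by apply: sumr_ge0 => i _; rewrite mulr_ge0 ?sqr_ge0 ?dp.1.
Qed.

(** The roots of an orthogonal polynomial lie in the convex hull of the support,
so it is nonnegative at any point c on one side of it. Concretely, with
u = c - lambda, the Cauchy-Schwarz inequality
E(u) E(u^3) >= E(u^2)^2 for u of constant sign reads V Q(c) >= 0. *)
Lemma orthopoly_ge0_out p (c : R) : prob_weights p -> wvar p != 0 ->
  (forall i j, 0 <= (c - lam i) * (c - lam j)) -> 0 <= orthopoly p c.
Proof.
move=> dp v0 cI; have [p0 p1] := dp.
have v_gt0 : 0 < wvar p by rewrite lt_neqAle eq_sym v0 wvar_ge0.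
pose u i := c - lam i.
have c0 := sum_center p1; have c3 := third_moment p1 v0.
set a := c - wmean p; set b := c - wmean (reweight p).
have E1 : \sum_i p i * u i = a.
  transitivity (\sum_i (p i * a - p i * (lam i - wmean p))).
    by apply: eq_bigr => i _; rewrite /u /a; ring.
  by rewrite sumrB c0 -mulr_suml p1; ring.
have E2 : \sum_i p i * u i ^+ 2 = a ^+ 2 + wvar p.
  transitivity (\sum_i (p i * a ^+ 2 - p i * (lam i - wmean p) * (2 * a)
     + p i * (lam i - wmean p) ^+ 2)).
    by apply: eq_bigr => i _; rewrite /u /a; ring.
  by rewrite big_split sumrB /= -!mulr_suml c0 p1 -/(wvar p); ring.
have E3 : \sum_i p i * u i ^+ 3
    = a ^+ 3 + 3 * a * wvar p - (a - b) * wvar p.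
  transitivity (\sum_i (p i * a ^+ 3 - p i * (lam i - wmean p) * (3 * a ^+ 2)
     + p i * (lam i - wmean p) ^+ 2 * (3 * a) - p i * (lam i - wmean p) ^+ 3)).
    by apply: eq_bigr => i _; rewrite /u /a; ring.
  rewrite sumrB big_split sumrB /= -!mulr_suml c0 p1 -/(wvar p) c3.
  by rewrite /a /b; ring.
(* Expanded, this double sum is 2 (E(u) E(u^3) - E(u^2)^2). *)
have : 0 <= \sum_i \sum_j p i * p j * (u i * u j) * (u i - u j) ^+ 2.
  apply: sumr_ge0 => i _; apply: sumr_ge0 => j _.
  by rewrite mulr_ge0 ?sqr_ge0 // mulr_ge0 ?cI // mulr_ge0.
have -> : \sum_i \sum_j p i * p j * (u i * u j) * (u i - u j) ^+ 2 =
    \sum_i (p i * u i ^+ 3 * (\sum_j p j * u j)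
      + p i * u i * (\sum_j p j * u j ^+ 3)
      - p i * u i ^+ 2 * (\sum_j p j * u j ^+ 2) * 2).
  apply: eq_bigr => i _; rewrite -[_ * _ * 2]mulrA.
  rewrite mulr_suml !mulr_sumr -big_split -sumrB /=.
  by apply: eq_bigr => j _; ring.
rewrite sumrB big_split /= -!mulr_suml E1 E2 E3 /orthopoly -/a -/b => h.
by rewrite -(pmulr_rge0 _ v_gt0) -(pmulr_rge0 _ (ltr0Sn R 1)); move: h; congr (_ <= _); ring.
Qed.

(** Two consecutive reweightings multiply p_i by
((lambda_i - m) (lambda_i - m'))^2 / (V V'), and the numerator is
(Q(lambda_i) + V)^2. *)
Lemma energy_reweight p i : wvar p != 0 -> wvar (reweight p) != 0 ->
  energy (reweight p) i =
  energy p i * ((orthopoly p (lam i) + wvar p) / wvar p) ^+ 2.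
Proof.
move=> v0 v1; rewrite /energy {2}/reweight mulrA mulfVK //.
rewrite /orthopoly subrK.
by move: (wmean (reweight p)) => b; rewrite /reweight; field.
Qed.

Lemma energy_increase p i : prob_weights p -> wvar p != 0 ->
  wvar (reweight p) != 0 ->
  energy p i + 2 * (p i * reweight p i) * orthopoly p (lam i)
    <= energy (reweight p) i.
Proof.
move=> dp v0 v1; rewrite energy_reweight // -subr_ge0.
have d' := reweight_prob_weights dp v0.
have -> : forall x : R, energy p i * ((x + wvar p) / wvar p) ^+ 2 -
  (energy p i + 2 * (p i * reweight p i) * x) =
    p i * reweight p i * x ^+ 2 / wvar p.
  by move=> x; rewrite /energy; field.
apply: divr_ge0; last exact: wvar_ge0.
by rewrite mulr_ge0 ?sqr_ge0 // mulr_ge0 ?dp.1 ?d'.1.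
Qed.

(** The two monic quadratic polynomials Q and (t - L) (t - l) differ by an affine
function, determined by the values of Q at L and l. *)
Lemma orthopoly_interpolation p (L l t : R) : L != l ->
  orthopoly p t = (t - L) * (t - l)
    + ((L - t) * orthopoly p l + (t - l) * orthopoly p L) / (L - l).
Proof. by move=> Ll; rewrite /orthopoly; field; rewrite subr_eq0. Qed.

End Distribution.

(** * The reweighting dynamics between the two extreme points *)

Lemma nondecreasing_bounded_step (R : realType) (u : nat -> R) (B e : R) :
  (forall k, u k <= u k.+1) -> (forall k, u k <= B) -> 0 < e ->
  exists K, forall k, (K <= k)%N -> u k.+1 - u k < e.
Proof.
move=> u_incr uB e0.
have nd : nondecreasing_seq u by apply/nondecreasing_seqP.
have cu : cvgn u.
  by apply: nondecreasing_is_cvgn => //; exists B => _ [k _ <-].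
have e2 : 0 < e / 2 by rewrite divr_gt0.
have /cvgrPdist_lt /(_ _ e2) [K _ KH] : u @ \oo --> limn u by exact: cu.
exists K => k Kk.
have h1 := KH k Kk; have h2 := KH k.+1 (leqW Kk).
rewrite /= in h1 h2.
move: h1 h2; rewrite !ltr_norml => /andP[? ?] /andP[? ?]; lra.
Qed.

Section Orbit.
Variables (R : realType) (I : finType) (lam : I -> R) (i0 iN : I).
Hypothesis lam_max : forall i, lam i <= lam i0.
Hypothesis lam_min : forall i, lam iN <= lam i.
Hypothesis lam_lt : lam iN < lam i0.
Implicit Types p : I -> R.

(** Both extreme points keep positive mass for ever, because the mean is strictly
between them. This keeps the variance positive. *)
Definition spread p := [/\ prob_weights p, 0 < p i0 & 0 < p iN].

Lemma subr_wmean p (c : R) : \sum_i p i = 1 ->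
  c - wmean lam p = \sum_i p i * (c - lam i).
Proof.
move=> p1; under eq_bigr do rewrite mulrBr.
by rewrite sumrB -mulr_suml p1 mul1r.
Qed.

Lemma wmean_lt_max p : spread p -> wmean lam p < lam i0.
Proof.
move=> [[p0 p1] _ pN]; rewrite -subr_gt0 subr_wmean // (bigD1 iN) //=.
apply: ltr_wpDr; last by rewrite mulr_gt0 // subr_gt0.
by apply: sumr_ge0 => i _; rewrite mulr_ge0 // subr_ge0.
Qed.

Lemma min_lt_wmean p : spread p -> lam iN < wmean lam p.
Proof.
move=> [[p0 p1] pi0 _]; rewrite -subr_lt0 subr_wmean // (bigD1 i0) //=.
rewrite -oppr_gt0 opprD; apply: ltr_wpDr; last first.
  by rewrite -mulrN mulr_gt0 // opprB subr_gt0.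
rewrite -sumrN.
by apply: sumr_ge0 => i _; rewrite -mulrN mulr_ge0 // opprB subr_ge0.
Qed.

Lemma wvar_gt0 p : spread p -> 0 < wvar lam p.
Proof.
move=> sp; have [[p0 p1] pi0 _] := sp.
rewrite /wvar (bigD1 i0) //= ltr_wpDr //.
  by apply: sumr_ge0 => i _; rewrite mulr_ge0 ?sqr_ge0.
by rewrite mulr_gt0 // exprn_gt0 // subr_gt0 wmean_lt_max.
Qed.

(** Bhatia-Davis inequality. *)
Lemma wvar_le_sides p : prob_weights p ->
  wvar lam p <= (lam i0 - wmean lam p) * (wmean lam p - lam iN).
Proof.
move=> [p0 p1]; rewrite -subr_ge0.
have -> : (lam i0 - wmean lam p) * (wmean lam p - lam iN) - wvar lam p =
    \sum_i p i * ((lam i0 - lam i) * (lam i - lam iN)).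
  transitivity (\sum_i
     (p i * ((lam i0 - wmean lam p) * (wmean lam p - lam iN))
      + p i * (lam i - wmean lam p) * (lam i0 + lam iN - 2 * wmean lam p)
      - p i * (lam i - wmean lam p) ^+ 2)).
    rewrite sumrB big_split /= -!mulr_suml sum_center // p1 /wvar; ring.
  by apply: eq_bigr => i _; ring.
by apply: sumr_ge0 => i _; rewrite mulr_ge0 // mulr_ge0 // subr_ge0.
Qed.

Lemma spread_reweight p : spread p -> spread (reweight lam p).
Proof.
move=> sp; have [dp pi0 pN] := sp; have v0 := wvar_gt0 sp.
split; first by apply: reweight_prob_weights => //; rewrite gt_eqF.
- by rewrite divr_gt0 // mulr_gt0 // exprn_gt0 // subr_gt0 wmean_lt_max.
rewrite divr_gt0 // mulr_gt0 // lt_neqAle sqr_ge0 andbT eq_sym sqrf_eq0.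
by rewrite subr_eq0 lt_eqF // min_lt_wmean.
Qed.

Lemma spread_iter p k : spread p -> spread (iter k (reweight lam) p).
Proof. by move=> sp; elim: k => //= k; exact: spread_reweight. Qed.

Section Trajectory.
Variable p : I -> R.
Hypothesis sp : spread p.
Let P k := iter k (reweight lam) p.
Let V k := wvar lam (P k).

Let sP k : spread (P k). Proof. exact: spread_iter. Qed.
Let dP k : prob_weights (P k). Proof. by have [] := sP k. Qed.
Let V_gt0 k : 0 < V k. Proof. exact: wvar_gt0. Qed.
Let V_neq0 k : V k != 0. Proof. by rewrite gt_eqF. Qed.

Lemma wvar_iter_nondecreasing k j : (k <= j)%N -> V k <= V j.
Proof.
suff /nondecreasing_seqP nd : forall k, V k <= V k.+1 by exact: nd.
by move=> m; exact: (le_wvar_reweight (dP m) (V_neq0 m)).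
Qed.

Let energy_le k i : energy lam (P k) i <= V k.
Proof.
rewrite /energy; apply: ler_piMl; first exact/ltW/V_gt0.
have p1 := prob_weights_le1 i (dP k); have p1' := prob_weights_le1 i (dP k.+1).
by apply: mulr_ile1 => //; [exact: (dP k).1 | exact: (dP k.+1).1].
Qed.

(** Where Q >= 0 the energy is nondecreasing and bounded, and its increments are
at least 2 p_i p'_i Q. The factor p_i p'_i stays away from 0, as the energy
does and the variance is bounded. *)
Lemma orthopoly_end_cvg0 (B e : R) i : (forall k, V k <= B) ->
  (forall k, 0 < P k i) ->
  (forall k, 0 <= orthopoly lam (P k) (lam i)) -> 0 < e ->
  exists K, forall k, (K <= k)%N -> orthopoly lam (P k) (lam i) < e.
Proof.
move=> VB Pi Q0 e0.
have B0 : 0 < B by exact: lt_le_trans (V_gt0 0) (VB 0).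
pose E k := energy lam (P k) i.
have incr k : E k + 2 * (P k i * P k.+1 i) * orthopoly lam (P k) (lam i) <= E k.+1.
  exact: (energy_increase _ (dP k) (V_neq0 k) (V_neq0 k.+1)).
have Pi2 k : 0 < P k i * P k.+1 i by rewrite mulr_gt0.
have nd k : E k <= E k.+1.
  by apply: le_trans (incr k); rewrite lerDl mulr_ge0 // mulr_ge0 // ltW.
have EB k : E k <= B by exact: le_trans (energy_le k i) (VB k).
have E0 : 0 < E 0 by exact: (mulr_gt0 (Pi2 0) (V_gt0 0)).
have cE k : E 0 / B <= P k i * P k.+1 i.
  rewrite ler_pdivrMr //; apply: (@le_trans _ _ (E k)).
    by have /nondecreasing_seqP ndE := nd; exact: ndE.
  by apply: ler_wpM2l (VB k); rewrite ltW // Pi2.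
have [|K KH] := nondecreasing_bounded_step (e := 2 * (E 0 / B) * e) nd EB.
  by rewrite pmulr_rgt0 // pmulr_rgt0 ?divr_gt0.
exists K => k Kk; have := KH k Kk; have := incr k; have := cE k.
have := Q0 k; have := Pi2 k.
have EB0 : 0 < E 0 / B by rewrite divr_gt0.
move: (orthopoly _ _ _) (P k i * _) (E 0 / B) EB0 (E k) (E k.+1).
move=> q c d d0 x y c0 q0 dc h1 h2.
have : d * q <= c * q by rewrite ler_wpM2r.
rewrite -(ltr_pM2l d0); lra.
Qed.

(** If the variance never reached c, then Q would become so negative at lambda_i
that the energy there grows geometrically, yet it is bounded by the variance. *)
Theorem wvar_eventually_ge (i : I) (c : R) :
  (forall k, P k i != 0) ->
  2 * c < (lam i0 - lam i) * (lam i - lam iN) ->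
  exists K, forall k, (K <= k)%N -> c <= V k.
Proof.
move=> Pi cw.
apply: contrapT => nK.
have Vc k : V k < c.
  rewrite ltNge; apply/negP => cV; apply: nK; exists k => j kj.
  exact: le_trans cV (wvar_iter_nondecreasing kj).
have Vc' k : V k <= c by exact: ltW.
have c0 : 0 < c by exact: lt_trans (V_gt0 0) (Vc 0).
set w := (lam i0 - lam i) * _ in cw.
pose d := w - 2 * c; have d0 : 0 < d by rewrite /d subr_gt0.
have d2 : 0 < d / 2 by rewrite divr_gt0.
have D0 : 0 < lam i0 - lam iN by rewrite subr_gt0.
have [K1 H1] : exists K, forall k, (K <= k)%N ->
    orthopoly lam (P k) (lam i0) < d / 2.
  apply: (orthopoly_end_cvg0 Vc') => // k; first by have [] := sP k.
  apply: (orthopoly_ge0_out (dP k) (V_neq0 k)) => a b.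
  by rewrite mulr_ge0 ?subr_ge0.
have [K2 H2] : exists K, forall k, (K <= k)%N ->
    orthopoly lam (P k) (lam iN) < d / 2.
  apply: (orthopoly_end_cvg0 Vc') => // k; first by have [] := sP k.
  apply: (orthopoly_ge0_out (dP k) (V_neq0 k)) => a b.
  by rewrite mulr_le0 ?subr_le0.
pose E k := energy lam (P k) i.
have Pi_gt0 k : 0 < P k i by rewrite lt_neqAle eq_sym Pi (dP k).1.
have E_gt0 k : 0 < E k.
  exact: (mulr_gt0 (mulr_gt0 (Pi_gt0 k) (Pi_gt0 k.+1)) (V_gt0 k)).
have Q_le k : (maxn K1 K2 <= k)%N -> orthopoly lam (P k) (lam i) <= - w + d / 2.
  rewrite geq_max => /andP[/H1 h1 /H2 h2].
  rewrite (@orthopoly_interpolation _ _ _ _ (lam i0) (lam iN)) ?gt_eqF //.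
  rewrite {1}/w -mulNr opprB lerD2l ler_pdivrMr //.
  apply: (@le_trans _ _ ((lam i0 - lam i) * (d / 2) + (lam i - lam iN) * (d / 2))).
    by apply: lerD; apply: ler_wpM2l; rewrite ?subr_ge0 // ltW.
  by rewrite le_eqVlt; apply/orP; left; apply/eqP; ring.
(* Eventually - (Q + V) >= w - d / 2 - c = c + d / 2, which is r times c. *)
pose r := 1 + d / (2 * c).
have r1 : 1 < r by rewrite ltrDl divr_gt0 // mulr_gt0.
have grow k : (maxn K1 K2 <= k)%N -> E k * r <= E k.+1.
  move=> /Q_le Qk.
  have -> : E k.+1 = E k * ((orthopoly lam (P k) (lam i) + V k) / V k) ^+ 2.
    exact: (energy_reweight _ (V_neq0 k) (V_neq0 k.+1)).
  rewrite ler_pM2l // -sqrrN -mulNr.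
  set x := - _ / _.
  have rx : r <= x.
    rewrite ler_pdivlMr //.
    apply: (@le_trans _ _ (r * c)); first by rewrite ler_pM2l // (lt_trans _ r1).
    have -> : r * c = c + d / 2 by rewrite /r; field; rewrite gt_eqF.
    by move: Qk (Vc' k); rewrite /d; lra.
  apply: (le_trans rx); rewrite ler_eXnr //.
  by rewrite (le_trans _ rx) // ltW.
pose M := maxn K1 K2.
have nd k : E (M + k)%N <= E (M + k.+1)%N.
  rewrite addnS; apply: le_trans (grow _ (leq_addr _ _)).
  by rewrite ler_pMr // ltW.
have [k||K3 H3] := @nondecreasing_bounded_step _ (fun k => E (M + k)%N) c
    (E M * (r - 1)) nd.
- exact: le_trans (energy_le _ _) (Vc' _).
- by rewrite mulr_gt0 // subr_gt0.
have := H3 _ (leqnn _); apply/negP; rewrite -leNgt.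
have EM : E M <= E (M + K3)%N.
  have /nondecreasing_seqP h := nd.
  by rewrite -[X in E X <= _]addn0; exact: h.
apply: (@le_trans _ _ (E (M + K3)%N * (r - 1))).
  by rewrite ler_pM2r // subr_gt0.
rewrite mulrBr mulr1 lerD2r addnS; exact: grow (leq_addr _ _).
Qed.
End Trajectory.
End Orbit.

(** * Gradient descent in coordinates and bounds on the rate of convergence *)

Section Moments.
Variables (R : realType) (n : nat).
Implicit Types (lam : 'rV[R]_n) (x : 'cV[R]_n).

Definition moment lam k x : R := \sum_i lam 0 i ^+ k * x i 0 ^+ 2.

Lemma momentZ lam k c x : moment lam k (c *: x) = c ^+ 2 * moment lam k x.
Proof.
by rewrite /moment mulr_sumr; apply: eq_bigr => i _; rewrite mxE; ring.
Qed.

Lemma diag_mx_exp lam k : diag_mx lam ^+ k = diag_mx (\row_i lam 0 i ^+ k).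
Proof.
elim: k => [|k IH].
  by rewrite expr0; apply/matrixP => i j; rewrite !mxE.
rewrite exprS IH -[_ * _]/(_ *m _) mulmx_diag; congr diag_mx.
by apply/rowP => i; rewrite !mxE exprS.
Qed.

Lemma qform_diag (d : 'rV[R]_n) x :
  qform (diag_mx d) x = \sum_i d 0 i * x i 0 ^+ 2.
Proof.
rewrite /qform mul_mx_diag mxE; apply: eq_bigr => i _.
by rewrite !mxE; ring.
Qed.

Lemma qform_diag_exp lam k x : qform (diag_mx lam ^+ k) x = moment lam k x.
Proof.
by rewrite diag_mx_exp qform_diag; apply: eq_bigr => i _; rewrite mxE.
Qed.

Lemma qform1_moment0 lam x : qform 1%:M x = moment lam 0 x.
Proof. by rewrite -qform_diag_exp expr0. Qed.

Lemma qform_diag1 lam x : qform (diag_mx lam) x = moment lam 1 x.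
Proof. by rewrite -qform_diag_exp expr1. Qed.

Lemma OGDE lam x i : OGD lam x i 0 =
  x i 0 * (1 - moment lam 2 x / moment lam 3 x * lam 0 i).
Proof.
rewrite /OGD; case: eqP => [->|_]; first by rewrite !mxE mul0r.
by rewrite !qform_diag_exp mul_diag_mx !mxE; ring.
Qed.

Lemma rhoE lam x : x != 0 -> rho lam x =
  Num.sqrt (1 - moment lam 2 x ^+ 2 / (moment lam 1 x * moment lam 3 x)).
Proof.
by move=> /negbTE x0; rewrite /rho x0 !qform_diag_exp qform_diag1.
Qed.

Lemma rho_ge0 lam x : 0 <= rho lam x.
Proof. by rewrite /rho; case: ifP => // _; exact: sqrtr_ge0. Qed.

Section Positive.
Variable lam : 'rV[R]_n.
Hypothesis lam_gt0 : forall i, 0 < lam 0 i.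

Lemma moment_ge0 k x : 0 <= moment lam k x.
Proof.
apply: sumr_ge0 => i _; rewrite mulr_ge0 ?sqr_ge0 // exprn_ge0 // ltW //.
Qed.

Lemma moment_gt0 k x : x != 0 -> 0 < moment lam k x.
Proof.
move=> x0; rewrite lt_neqAle moment_ge0 andbT eq_sym.
apply: contra x0; rewrite psumr_eq0; last first.
  by move=> i _; rewrite mulr_ge0 ?sqr_ge0 // exprn_ge0 // ltW //.
move=> /allP h; apply/eqP/colP => i; rewrite mxE; apply/eqP.
have := h i (mem_index_enum i).
by rewrite /= mulf_eq0 expf_eq0 gt_eqF // andbF sqrf_eq0.
Qed.

Lemma rho_le1 x : rho lam x <= 1.
Proof.
have [->|x0] := eqVneq x 0; first by rewrite /rho eqxx.
rewrite rhoE // -[leRHS]sqrtr1 ler_wsqrtr // lerBlDr lerDl.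
by rewrite divr_ge0 ?sqr_ge0 // mulr_ge0 ?moment_ge0.
Qed.

(** The A-norm contracts by rho, so the product of the first k factors is the
ratio of the A-norms of the k-th iterate and of the starting point. *)
Lemma moment1_OGD x : moment lam 1 (OGD lam x) = rho lam x ^+ 2 * moment lam 1 x.
Proof.
have [->|x0] := eqVneq x 0.
  by rewrite /OGD /rho eqxx expr0n mul0r /moment big1 // => i _; rewrite mxE expr0n mulr0.
have m1 := moment_gt0 1 x0; have m3 := moment_gt0 3 x0.
have E : moment lam 1 (OGD lam x) =
    moment lam 1 x - moment lam 2 x ^+ 2 / moment lam 3 x.
  set t := moment lam 2 x / moment lam 3 x.
  transitivity (\sum_i (lam 0 i ^+ 1 * x i 0 ^+ 2
     - (lam 0 i ^+ 2 * x i 0 ^+ 2) * (2 * t) + lam 0 i ^+ 3 * x i 0 ^+ 2 * t ^+ 2)).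
    by apply: eq_bigr => i _; rewrite OGDE -/t; ring.
  rewrite big_split sumrB /= -!mulr_suml -/(moment lam 1 x) -/(moment lam 2 x).
  by rewrite -/(moment lam 3 x) /t; field; rewrite gt_eqF.
have e : moment lam 1 x - moment lam 2 x ^+ 2 / moment lam 3 x =
   (1 - moment lam 2 x ^+ 2 / (moment lam 1 x * moment lam 3 x)) * moment lam 1 x.
  by field; rewrite !gt_eqF.
by rewrite E e rhoE // sqr_sqrtr // -(pmulr_lge0 _ m1) -e -E moment_ge0.
Qed.

Lemma prod_rho_ge0 k x : 0 <= \prod_(j < k) rho lam (iter j (OGD lam) x).
Proof. by apply: prodr_ge0 => j _; exact: rho_ge0. Qed.

Lemma prod_rho_le1 k x : \prod_(j < k) rho lam (iter j (OGD lam) x) <= 1.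
Proof.
apply: (@le_trans _ _ (\prod_(j < k) 1)); last by rewrite big1.
by apply: ler_prod => j _; rewrite rho_ge0 rho_le1.
Qed.

Lemma moment1_iter k x : moment lam 1 (iter k (OGD lam) x) =
  (\prod_(j < k) rho lam (iter j (OGD lam) x)) ^+ 2 * moment lam 1 x.
Proof.
elim: k => [|k IH]; first by rewrite big_ord0 expr1n mul1r.
by rewrite iterS moment1_OGD IH big_ord_recr /=; ring.
Qed.

Let u x k := (\prod_(j < k) rho lam (iter j (OGD lam) x)) `^ (k%:R^-1).

Lemma ROC_term01 x k : 0 <= u x k <= 1.
Proof.
rewrite powR_ge0 /= (_ : 1 = 1 `^ k%:R^-1); last by rewrite powR1.
by rewrite ge0_ler_powR ?nnegrE ?invr_ge0 ?prod_rho_ge0 ?prod_rho_le1.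
Qed.

Lemma ROC_bounded x : bounded_fun (u x).
Proof.
exists 1; split=> // M M1 k _; have /andP[u0 u1] := ROC_term01 x k.
by rewrite /= ger0_norm // (le_trans u1) // ltW.
Qed.

Lemma ROC_infE x : ROC lam x = inf (range (sups (u x))).
Proof. exact: limn_supE (ROC_bounded x). Qed.

Lemma sups_ub x m k : (m <= k)%N -> u x k <= sups (u x) m.
Proof.
move=> mk; apply: ub_le_sup; last by exists k.
apply: has_ubound_sdrop; exists 1 => _ [j _ <-].
by case/andP: (ROC_term01 x j).
Qed.

Lemma sups_ge0 x m : 0 <= sups (u x) m.
Proof. by apply: le_trans (sups_ub x (leqnn m)); case/andP: (ROC_term01 x m). Qed.

Lemma ROC_ge0 x : 0 <= ROC lam x.
Proof.
rewrite ROC_infE; apply: lb_le_inf; first by exists (sups (u x) 0); exists 0.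
by move=> _ [m _ <-]; exact: sups_ge0.
Qed.

Lemma ROC_le x r : (forall k, rho lam (iter k (OGD lam) x) <= r) ->
  ROC lam x <= r.
Proof.
move=> xr; have r0 : 0 <= r by exact: le_trans (rho_ge0 _ _) (xr 0).
rewrite ROC_infE; apply: (@le_trans _ _ (sups (u x) 1)).
  apply: ge_inf; last by exists 1.
  by exists 0 => _ [m _ <-]; exact: sups_ge0.
apply: ge_sup; first by exists (u x 1); exists 1.
move=> _ [k /= k0 <-].
apply: (@le_trans _ _ ((r ^+ k) `^ k%:R^-1)).
  rewrite ge0_ler_powR ?nnegrE ?invr_ge0 ?prod_rho_ge0 ?exprn_ge0 //.
  rewrite -[X in r ^+ X]card_ord -prodr_const; apply: ler_prod => j _.
  by rewrite rho_ge0 xr.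
by rewrite -powR_mulrn // -powRrM divff ?powRr1 // pnatr_eq0 -lt0n.
Qed.

(** Constant factors are invisible in a k-th root: for q < r, C r^k exceeds q^k
for large k. *)
Lemma ROC_ge x (C r : R) K : 0 < C ->
  (forall k, (K <= k)%N ->
    C * r ^+ k <= \prod_(j < k) rho lam (iter j (OGD lam) x)) ->
  0 <= r -> r <= ROC lam x.
Proof.
move=> C0 xr; rewrite le_eqVlt => /predU1P[<-|r0]; first exact: ROC_ge0.
rewrite ROC_infE; apply: lb_le_inf; first by exists (sups (u x) 0); exists 0.
move=> _ [m _ <-]; rewrite leNgt; apply/negP => sr.
set s := sups (u x) m in sr *; have s0 : 0 <= s by exact: sups_ge0.
(* Any q strictly between s and r contradicts that s bounds the tail. *)
pose q := (s + r) / 2.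
have [q0 sq qr] : [/\ 0 < q, s < q & q < r] by rewrite /q; split; lra.
have : (q / r) ^+ k @[k --> \oo] --> 0.
  apply: cvg_expr; have qr0 : 0 <= q / r by rewrite divr_ge0 // ltW.
  by rewrite ger0_norm // ltr_pdivrMr // mul1r.
move=> /cvgrPdist_lt /(_ _ C0) [N _ NH].
pose k := (N + K + m).+1.
have kN : (N <= k)%N by rewrite /k; lia.
have kK : (K <= k)%N by rewrite /k; lia.
have km : (m <= k)%N by rewrite /k; lia.
have := NH k kN; rewrite /= sub0r normrN ger0_norm; last first.
  by rewrite exprn_ge0 // divr_ge0 // ltW.
rewrite expr_div_n ltr_pdivrMr ?exprn_gt0 // => qC.
have : q <= u x k.
  apply: (@le_trans _ _ ((q ^+ k) `^ k%:R^-1)).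
    have q0' := ltW q0.
    by rewrite -powR_mulrn // -powRrM divff ?powRr1 // pnatr_eq0.
  rewrite ge0_ler_powR ?nnegrE ?invr_ge0 ?prod_rho_ge0 ?exprn_ge0 ?(ltW q0) //.
  exact: le_trans (ltW qC) (xr _ kK).
by apply/negP; rewrite -ltNge (le_lt_trans _ sq) // sups_ub.
Qed.

End Positive.
End Moments.

(** * The worst case and the case of two eigenvalues *)

Section Worst.
Variables (R : realType) (n : nat) (lam : 'rV[R]_n) (i0 iN : 'I_n).
Hypothesis lam_gt0 : forall i, 0 < lam 0 i.
Hypothesis lam_max : forall i, lam 0 i <= lam 0 i0.
Hypothesis lam_min : forall i, lam 0 iN <= lam 0 i.
Let L := lam 0 i0.
Let l := lam 0 iN.
Implicit Types x : 'cV[R]_n.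

Let L0 : 0 < L. Proof. exact: lam_gt0. Qed.
Let l0 : 0 < l. Proof. exact: lam_gt0. Qed.

(** From (L - lambda_i) (lambda_i - l) >= 0 one gets
S3 + L l S1 <= (L + l) S2 for the moments S1, S2, S3 of x, and then
4 L l S1 S3 <= (S3 + L l S1)^2 concludes. *)
Lemma rho_le_kantorovich x : rho lam x <= (L - l) / (L + l).
Proof.
have W0 : 0 <= (L - l) / (L + l).
  by rewrite divr_ge0 ?subr_ge0 ?lam_max // addr_ge0 ?ltW.
have [->|x0] := eqVneq x 0; first by rewrite /rho eqxx.
rewrite rhoE // -[leRHS]ger0_norm // -sqrtr_sqr ler_wsqrtr //.
have m1 := moment_gt0 lam_gt0 1 x0; have m3 := moment_gt0 lam_gt0 3 x0.
have key : moment lam 3 x + L * l * moment lam 1 x <= (L + l) * moment lam 2 x.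
  rewrite -subr_ge0.
  have -> : (L + l) * moment lam 2 x - (moment lam 3 x + L * l * moment lam 1 x) =
      \sum_i lam 0 i * x i 0 ^+ 2 * ((L - lam 0 i) * (lam 0 i - l)).
    by rewrite /moment !mulr_sumr -big_split -sumrB /=; apply: eq_bigr => i _; ring.
  apply: sumr_ge0 => i _; apply: mulr_ge0.
    by rewrite mulr_ge0 ?sqr_ge0 ?ltW.
  by rewrite mulr_ge0 ?subr_ge0.
have D0 : 0 < moment lam 1 x * moment lam 3 x by rewrite mulr_gt0.
have Ll : 0 < L + l by rewrite addr_gt0.
rewrite lerBlDr expr_div_n -lerBlDl ler_pdivlMr //.
have -> : 1 - (L - l) ^+ 2 / (L + l) ^+ 2 = 4 * L * l / (L + l) ^+ 2.
  by field; rewrite gt_eqF.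
rewrite mulrAC ler_pdivrMr ?exprn_gt0 // -exprMn mulrC.
rewrite [X in _ <= X ^+ 2]mulrC in key *.
have s0 : 0 <= moment lam 3 x + L * l * moment lam 1 x.
  by rewrite addr_ge0 ?mulr_ge0 ?ltW.
have : (moment lam 3 x + L * l * moment lam 1 x) ^+ 2
   <= ((L + l) * moment lam 2 x) ^+ 2 by rewrite lerXn2r ?nnegrE // (le_trans s0).
apply: le_trans.
rewrite -subr_ge0; apply: le_trans (sqr_ge0 (moment lam 3 x - L * l * moment lam 1 x)) _.
by rewrite le_eqVlt; apply/orP; left; apply/eqP; ring.
Qed.

Definition on_ends x := (forall i, i != i0 -> i != iN -> x i 0 = 0).

Lemma moment_on_ends k x : i0 != iN -> on_ends x ->
  moment lam k x = L ^+ k * x i0 0 ^+ 2 + l ^+ k * x iN 0 ^+ 2.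
Proof.
move=> i0N ex; rewrite /moment (bigD1 i0) //= (bigD1 iN) 1?eq_sym //=.
rewrite big1 ?addr0 // => i /andP[h1 h2].
by rewrite ex // expr0n mulr0.
Qed.

(** If the gradient has entries of equal modulus at the two ends and vanishes
elsewhere, then the step length is 2 / (L + l): both entries are multiplied by
the worst factor up to sign, and the shape is preserved. *)
Lemma ROC_balanced x : l < L -> on_ends x ->
  L ^+ 2 * x i0 0 ^+ 2 = l ^+ 2 * x iN 0 ^+ 2 -> x i0 0 != 0 ->
  ROC lam x = (L - l) / (L + l).
Proof.
move=> lL; have i0N : i0 != iN by apply: contraTneq lL => e; rewrite /L e ltxx.
have W0 : 0 < (L - l) / (L + l) by rewrite divr_gt0 ?subr_gt0 ?addr_gt0.
pose balanced x := [/\ on_ends x, L ^+ 2 * x i0 0 ^+ 2 = l ^+ 2 * x iN 0 ^+ 2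
  & x i0 0 != 0].
have mE y : balanced y -> exists a : R,
   [/\ a != 0, moment lam 1 y = a * (1 / L + 1 / l), moment lam 2 y = 2 * a
     & moment lam 3 y = a * (L + l)].
  move=> [ey eqy y0]; pose a := L ^+ 2 * y i0 0 ^+ 2; exists a.
  rewrite !moment_on_ends //.
  have a0 : a != 0 by rewrite /a mulf_neq0 ?expf_neq0 // gt_eqF.
  have -> : y iN 0 ^+ 2 = a / l ^+ 2.
    by rewrite /a eqy; field; rewrite gt_eqF.
  have -> : y i0 0 ^+ 2 = a / L ^+ 2 by rewrite /a; field; rewrite gt_eqF.
  split => //.
  - by field; rewrite !gt_eqF.
  - by field; rewrite !gt_eqF.
  - by field; rewrite !gt_eqF.
have rhoW y : balanced y -> rho lam y = (L - l) / (L + l).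
  move=> by_; have [a [a0 e1 e2 e3]] := mE y by_.
  have y0 : y != 0.
    by have [_ _] := by_; apply: contraNneq => ->; rewrite mxE.
  rewrite rhoE // -[RHS]ger0_norm ?(ltW W0) // -sqrtr_sqr e1 e2 e3.
  congr Num.sqrt; field.
  by rewrite a0 !gt_eqF ?addr_gt0.
have step y : balanced y -> balanced (OGD lam y).
  move=> by_; have [a [a0 e1 e2 e3]] := mE y by_; have [ey eqy y0] := by_.
  have OE i : OGD lam y i 0 = y i 0 * (1 - 2 / (L + l) * lam 0 i).
    rewrite OGDE e2 e3; congr (_ * (1 - _ * _)); field.
    by rewrite a0 gt_eqF ?addr_gt0.
  have OE0 : OGD lam y i0 0 = - ((L - l) / (L + l)) * y i0 0.
    by rewrite OE -/L; field; rewrite gt_eqF ?addr_gt0.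
  have OEN : OGD lam y iN 0 = (L - l) / (L + l) * y iN 0.
    by rewrite OE -/l; field; rewrite gt_eqF ?addr_gt0.
  split.
  - by move=> i h1 h2; rewrite OE ey // mul0r.
  - by rewrite OE0 OEN mulNr sqrrN; set W := _ / _; rewrite !exprMn mulrCA eqy mulrCA.
  - by rewrite OE0 mulf_neq0 // oppr_eq0 gt_eqF.
move=> ex eqx x0.
have bal k : balanced (iter k (OGD lam) x) by elim: k => // k; exact: step.
apply/eqP; rewrite eq_le; apply/andP; split.
  by apply: ROC_le => // k; exact: rho_le_kantorovich.
apply: (@ROC_ge _ _ _ lam_gt0 x 1 _ 0) => // [k _|]; last exact: ltW.
rewrite mul1r -[X in _ ^+ X]card_ord -prodr_const; apply: ler_prod => j _.
by rewrite ltW // rhoW ?lexx.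
Qed.

Lemma sphere_normalize x : x != 0 ->
  @sphere R n ((Num.sqrt (moment lam 0 x))^-1 *: x).
Proof.
move=> x0; have m0 := moment_gt0 lam_gt0 0 x0.
rewrite /sphere /= (qform1_moment0 lam).
by rewrite momentZ exprVn sqr_sqrtr ?ltW // mulVf // gt_eqF.
Qed.

Theorem worstROCE : worstROC lam = (L - l) / (L + l).
Proof.
have W0 : 0 <= (L - l) / (L + l).
  by rewrite divr_ge0 ?subr_ge0 ?lam_max // addr_ge0 ?ltW.
have ub x : ROC lam x <= (L - l) / (L + l).
  by apply: ROC_le => // k; exact: rho_le_kantorovich.
suff [x [Sx Rx]] : exists x, @sphere R n x /\ ROC lam x = (L - l) / (L + l).
  apply/eqP; rewrite eq_le; apply/andP; split.
    by apply: ge_sup; [exists (ROC lam x); exists x | move=> _ [y _ <-]].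
  apply: ub_le_sup; last by exists x.
  by exists ((L - l) / (L + l)) => _ [y _ <-].
pose z : 'cV[R]_n := \col_i (if (i == i0) || (i == iN) then (lam 0 i)^-1 else 0).
have z0 : z i0 0 != 0 by rewrite mxE eqxx invr_neq0 // gt_eqF.
have z_neq0 : z != 0 by apply: contraNneq z0 => ->; rewrite mxE.
have m0 := moment_gt0 lam_gt0 0 z_neq0.
exists ((Num.sqrt (moment lam 0 z))^-1 *: z); split; first exact: sphere_normalize.
have := lam_min i0; rewrite -/l -/L le_eqVlt => /predU1P[lL|lL].
  by apply/eqP; rewrite eq_le ub /= lL subrr mul0r ROC_ge0.
apply: ROC_balanced => //.
- by move=> i h1 h2; rewrite !mxE (negbTE h1) (negbTE h2) mulr0.
- rewrite !mxE !eqxx orbT /= -/L -/l.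
  by field; rewrite sqrtr_eq0 -ltNge m0 !gt_eqF.
- by rewrite mxE mulf_neq0 // invr_neq0 // sqrtr_eq0 -ltNge.
Qed.

(** A step maps the squared gradient norms u, v in the two eigenspaces to
a v, a u for a common factor a, so u v K <= u^2 + v^2 is preserved. On the
sphere it holds initially with K = (L / l)^2 x_1^2, since u >= L^2 x_1^2 and
v <= l^2. Under it, the explicit value of rho^2 is at most l / (L x_1^2). *)
Lemma ROC_two_eigenvalues x : (forall i, lam 0 i = L \/ lam 0 i = l) ->
  @sphere R n x -> x i0 0 != 0 ->
  ROC lam x <= Num.sqrt (l / (L * x i0 0 ^+ 2)).
Proof.
move=> two Sx x0.
pose u (y : 'cV[R]_n) := \sum_(i | lam 0 i == L) lam 0 i ^+ 2 * y i 0 ^+ 2.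
pose v (y : 'cV[R]_n) := \sum_(i | lam 0 i != L) lam 0 i ^+ 2 * y i 0 ^+ 2.
have u0 y : 0 <= u y by apply: sumr_ge0 => i _; rewrite mulr_ge0 ?sqr_ge0.
have v0 y : 0 <= v y by apply: sumr_ge0 => i _; rewrite mulr_ge0 ?sqr_ge0.
have vl i : lam 0 i != L -> lam 0 i = l.
  by case: (two i) => [->|//]; rewrite eqxx.
have mE k y : moment lam k y = u y * (L ^+ k / L ^+ 2) + v y * (l ^+ k / l ^+ 2).
  rewrite /moment (bigID (fun i => lam 0 i == L)) /= !mulr_suml.
  congr (_ + _); apply: eq_bigr => i.
    by move=> /eqP ->; field; rewrite gt_eqF.
  by move=> /vl ->; field; rewrite gt_eqF.
pose K := (L / l) ^+ 2 * x i0 0 ^+ 2.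
pose inv y := u y * v y * K <= u y ^+ 2 + v y ^+ 2.
have m1E y : moment lam 1 y = u y / L + v y / l.
  by rewrite mE; field; rewrite !gt_eqF.
have m2E y : moment lam 2 y = u y + v y.
  by rewrite mE; field; rewrite !gt_eqF.
have m3E y : moment lam 3 y = u y * L + v y * l.
  by rewrite mE; field; rewrite !gt_eqF.
have step y : inv y -> inv (OGD lam y).
  rewrite /inv => iy.
  have [->|y0] := eqVneq y 0.
    by rewrite /OGD eqxx [u 0]big1 ?mul0r ?addr_ge0 ?sqr_ge0 // => i _;
       rewrite mxE expr0n mulr0.
  pose t := moment lam 2 y / moment lam 3 y.
  have m3 := moment_gt0 lam_gt0 3 y0.
  have uE : u (OGD lam y) = u y * (1 - t * L) ^+ 2.
    rewrite /u mulr_suml; apply: eq_bigr => i /eqP e.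
    by rewrite OGDE -/t e; ring.
  have vE : v (OGD lam y) = v y * (1 - t * l) ^+ 2.
    rewrite /v mulr_suml; apply: eq_bigr => i /vl e.
    by rewrite OGDE -/t e; ring.
  have tL : 1 - t * L = v y * (l - L) / moment lam 3 y.
    rewrite /t m2E; move: (m3); rewrite m3E => m3'; field; rewrite gt_eqF //.
  have tl : 1 - t * l = u y * (L - l) / moment lam 3 y.
    rewrite /t m2E; move: (m3); rewrite m3E => m3'; field; rewrite gt_eqF //.
  pose z := ((L - l) / moment lam 3 y) ^+ 2.
  have {}uE : u (OGD lam y) = u y * v y * z * v y.
    by rewrite uE tL /z; field; rewrite gt_eqF.
  have {}vE : v (OGD lam y) = u y * v y * z * u y.
    by rewrite vE tl /z; field; rewrite gt_eqF.
  rewrite uE vE; set a := u y * v y * z.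
  have -> : a * v y * (a * u y) * K = a ^+ 2 * (u y * v y * K) by ring.
  have -> : (a * v y) ^+ 2 + (a * u y) ^+ 2 = a ^+ 2 * (u y ^+ 2 + v y ^+ 2).
    by ring.
  by rewrite ler_wpM2l ?sqr_ge0.
have init : inv x.
  rewrite /inv; apply: (@le_trans _ _ (u x ^+ 2)); last by rewrite lerDl sqr_ge0.
  rewrite -mulrA expr2 ler_wpM2l //.
  have vx : v x <= l ^+ 2.
    have := Sx; rewrite /sphere /= (qform1_moment0 lam) => S1.
    rewrite -[leRHS]mulr1 -S1 /moment mulr_sumr [leRHS](bigID (fun i => lam 0 i == L)) /=.
    rewrite ler_wpDl //.
      by apply: sumr_ge0 => i _; rewrite expr0 mul1r mulr_ge0 ?sqr_ge0.
    by apply: ler_sum => i /vl ->; rewrite expr0 mul1r.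
  have ux : L ^+ 2 * x i0 0 ^+ 2 <= u x.
    rewrite /u (bigD1 i0) //= -/L lerDl; apply: sumr_ge0 => i _.
    by rewrite mulr_ge0 ?sqr_ge0.
  apply: le_trans ux; rewrite /K.
  have -> : L ^+ 2 * x i0 0 ^+ 2 = l ^+ 2 * ((L / l) ^+ 2 * x i0 0 ^+ 2).
    by field; rewrite gt_eqF.
  by rewrite ler_wpM2r // mulr_ge0 ?sqr_ge0.
have all_inv k : inv (iter k (OGD lam) x) by elim: k => // k; exact: step.
apply: ROC_le => // k; move: (iter k _ _) (all_inv k) => y iy.
have [->|y0] := eqVneq y 0; first by rewrite /rho eqxx sqrtr_ge0.
rewrite rhoE // ler_wsqrtr //.
have m1 := moment_gt0 lam_gt0 1 y0; have m3 := moment_gt0 lam_gt0 3 y0.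
have D0 : 0 < moment lam 1 y * moment lam 3 y by rewrite mulr_gt0.
have x2 : 0 < x i0 0 ^+ 2 by rewrite lt_neqAle sqr_ge0 andbT eq_sym sqrf_eq0.
have -> : 1 - moment lam 2 y ^+ 2 / (moment lam 1 y * moment lam 3 y) =
   (moment lam 1 y * moment lam 3 y - moment lam 2 y ^+ 2) / (moment lam 1 y * moment lam 3 y).
  by field; rewrite !gt_eqF.
rewrite ler_pdivrMr // m1E m2E m3E.
have -> : (u y / L + v y / l) * (u y * L + v y * l) - (u y + v y) ^+ 2 =
    u y * v y * ((L - l) ^+ 2 / (L * l)) by field; rewrite !gt_eqF.
apply: (@le_trans _ _ (u y * v y * (L / l))).
  rewrite ler_wpM2l ?mulr_ge0 // -subr_ge0.
  have -> : L / l - (L - l) ^+ 2 / (L * l) = (2 * L - l) / L.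
    by field; rewrite !gt_eqF.
  have := lam_max iN; rewrite -/L -/l => lL.
  by rewrite divr_ge0 ?(ltW L0) //; move: (L0) (l0); lra.
have B0 : 0 <= l / (L * x i0 0 ^+ 2).
  by apply: divr_ge0; [exact: ltW | apply: mulr_ge0; exact: ltW].
apply: (@le_trans _ _ (l / (L * x i0 0 ^+ 2) * (u y ^+ 2 + v y ^+ 2))).
  have -> : u y * v y * (L / l) = l / (L * x i0 0 ^+ 2) * (u y * v y * K).
    by rewrite /K; field; rewrite x0 !gt_eqF.
  by rewrite ler_wpM2l.
apply: ler_wpM2l => //.
have -> : (u y / L + v y / l) * (u y * L + v y * l) =
   u y ^+ 2 + v y ^+ 2 + u y * v y * (l / L + L / l).
  by field; rewrite !gt_eqF.
by rewrite lerDl mulr_ge0 ?mulr_ge0 // addr_ge0 // divr_ge0 // ltW.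
Qed.

End Worst.

(** * The generic case: from gradient descent to reweighting *)

Section Weights.
Variables (R : realType) (n : nat) (lam : 'rV[R]_n) (i0 iN : 'I_n).
Hypothesis lam_gt0 : forall i, 0 < lam 0 i.
Hypothesis lam_max : forall i, lam 0 i <= lam 0 i0.
Hypothesis lam_min : forall i, lam 0 iN <= lam 0 i.
Hypothesis lam_lt : lam 0 iN < lam 0 i0.
Let L := lam 0 i0.
Let l := lam 0 iN.
Implicit Types x : 'cV[R]_n.

Definition weight x : 'I_n -> R :=
  fun i => lam 0 i ^+ 2 * x i 0 ^+ 2 / moment lam 2 x.

Lemma weight_prob_weights x : x != 0 -> prob_weights (weight x).
Proof.
move=> x0; have m2 := moment_gt0 lam_gt0 2 x0; split=> [i|].
  by apply: divr_ge0; [rewrite mulr_ge0 ?sqr_ge0 | exact: ltW].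
by rewrite /weight -mulr_suml divff // gt_eqF.
Qed.

Lemma wmean_weight x : wmean (lam 0) (weight x) = moment lam 3 x / moment lam 2 x.
Proof. by rewrite /wmean mulr_suml; apply: eq_bigr => i _; rewrite /weight; ring. Qed.

(** The inverse of the exact step length is the mean of the eigenvalues for the
weights of x. *)
Lemma OGD_wmean x i : x != 0 ->
  OGD lam x i 0 = x i 0 * (1 - lam 0 i / wmean (lam 0) (weight x)).
Proof.
move=> x0; rewrite OGDE wmean_weight.
have m2 := moment_gt0 lam_gt0 2 x0; have m3 := moment_gt0 lam_gt0 3 x0.
by field; rewrite !gt_eqF.
Qed.

Lemma weight_OGD x : x != 0 -> wvar (lam 0) (weight x) != 0 ->
  weight (OGD lam x) = reweight (lam 0) (weight x).
Proof.
move=> x0; have m2 := moment_gt0 lam_gt0 2 x0; have m3 := moment_gt0 lam_gt0 3 x0.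
set V := wvar _ _ => V0.
have OE := OGD_wmean _ x0; set m := wmean _ _ in OE.
have m0 : m != 0 by rewrite /m wmean_weight gt_eqF // divr_gt0.
have m2E : moment lam 2 (OGD lam x) = moment lam 2 x * V / m ^+ 2.
  rewrite /V /wvar -/m mulr_sumr mulr_suml; apply: eq_bigr => i _.
  by rewrite OE /weight; field; rewrite m0 gt_eqF.
apply/funext => i; rewrite /reweight -/V -/m /weight m2E OE.
by field; rewrite V0 m0 gt_eqF.
Qed.

Lemma weight_spread x : x i0 0 != 0 -> x iN 0 != 0 -> spread i0 iN (weight x).
Proof.
move=> x0 xN; have xn0 : x != 0 by apply: contraNneq x0 => ->; rewrite mxE.
have m2 := moment_gt0 lam_gt0 2 xn0.
split; first exact: weight_prob_weights.
- rewrite divr_gt0 // lt_neqAle mulr_ge0 ?sqr_ge0 // andbT eq_sym.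
  by rewrite mulf_neq0 ?expf_neq0 // gt_eqF.
- rewrite divr_gt0 // lt_neqAle mulr_ge0 ?sqr_ge0 // andbT eq_sym.
  by rewrite mulf_neq0 ?expf_neq0 // gt_eqF.
Qed.

Lemma weight_iter x k : x i0 0 != 0 -> x iN 0 != 0 ->
  iter k (OGD lam) x != 0 /\
  weight (iter k (OGD lam) x) = iter k (reweight (lam 0)) (weight x).
Proof.
move=> x0 xN; have sp := weight_spread x0 xN.
elim: k => [|k [y0 IH]]; first by split=> //=; apply: contraNneq x0 => ->; rewrite mxE.
have spk : spread i0 iN (weight (iter k (OGD lam) x)).
  by rewrite IH; exact: spread_iter.
have v0 : wvar (lam 0) (weight (iter k (OGD lam) x)) != 0.
  by rewrite gt_eqF // (wvar_gt0 lam_max lam_lt spk).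
have wE := weight_OGD y0 v0.
rewrite !iterS -IH -wE; split=> //.
apply/eqP => e0; have [_] := spread_reweight lam_max lam_min lam_lt spk.
by rewrite -wE e0 /weight mxE expr0n mulr0 mul0r ltxx.
Qed.

(** Eventually the variance is at least c, which keeps the mean m at distance
c / (L - l) from l by the Bhatia-Davis inequality. From then on the last
coordinate shrinks by a factor 1 - l / m >= 1 - l (L - l) / c at each step, and
the A-norm is at least a constant times its absolute value. *)
Theorem ROC_generic_ge x i (c : R) :
  (forall k, iter k (OGD lam) x i 0 != 0) -> x i0 0 != 0 -> x iN 0 != 0 ->
  0 < c -> 2 * c < (L - lam 0 i) * (lam 0 i - l) ->
  0 <= 1 - l * (L - l) / c -> 1 - l * (L - l) / c <= ROC lam x.
Proof.
move=> xi x0 xN c0 cw; set r := 1 - _ => r0.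
have sp := weight_spread x0 xN.
have W k := weight_iter k x0 xN.
pose p k := iter k (reweight (lam 0)) (weight x).
have spk k : spread i0 iN (p k) by exact: spread_iter.
have [|K KH] := @wvar_eventually_ge _ _ _ _ _ lam_max lam_min lam_lt _ sp i c _ cw.
  move=> k; have [y0 <-] := W k.
  apply: mulf_neq0; last by rewrite invr_eq0 gt_eqF // moment_gt0.
  by rewrite mulf_neq0 ?expf_neq0 // gt_eqF.
have D0 : 0 < L - l by rewrite subr_gt0.
pose y k := iter k (OGD lam) x.
have yN k : y k.+1 iN 0 = y k iN 0 * (1 - l / wmean (lam 0) (p k)).
  by have [y0 e] := W k; rewrite /y iterS OGD_wmean // e.
have m_gt k : l < wmean (lam 0) (p k) by exact: (min_lt_wmean lam_min lam_lt (spk k)).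
have l0 : 0 < l by exact: lam_gt0.
have m_gt0 k : 0 < wmean (lam 0) (p k) by exact: lt_trans (m_gt k).
have fac_gt0 k : 0 < 1 - l / wmean (lam 0) (p k).
  by rewrite subr_gt0 ltr_pdivrMr // mul1r.
have yN0 k : y k iN 0 != 0.
  by elim: k => // k IH; rewrite yN mulf_neq0 // gt_eqF.
have fac_ge k : (K <= k)%N -> r <= 1 - l / wmean (lam 0) (p k).
  move=> /KH cV; rewrite /r lerD2l lerN2 -mulrA; apply: ler_wpM2l; first exact: ltW.
  rewrite -invf_div lef_pV2 ?posrE ?divr_gt0 //.
  rewrite ler_pdivrMr //.
  have [dpk _ _] := spk k.
  apply: (le_trans cV); apply: (le_trans (wvar_le_sides lam_max lam_min dpk)).
  rewrite mulrC; apply: ler_pM; rewrite ?subr_ge0 ?ltW //.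
  - exact: (wmean_lt_max lam_max lam_lt (spk k)).
  - by rewrite gtrBl.
  - by rewrite ltrD2l ltrN2.
pose S := moment lam 1 x.
have xn0 : x != 0 by apply: contraNneq x0 => ->; rewrite mxE.
have S0 : 0 < S by exact: moment_gt0.
apply: (@ROC_ge _ _ _ lam_gt0 x (`|y K iN 0| * Num.sqrt (l / S)) r K) => //.
  by rewrite mulr_gt0 ?normr_gt0 // sqrtr_gt0 divr_gt0.
have low j : `|y K iN 0| * r ^+ j <= `|y (K + j)%N iN 0|.
  elim: j => [|j IH]; first by rewrite expr0 mulr1 addn0.
  rewrite addnS yN normrM exprSr mulrA; apply: ler_pM => //.
    by rewrite mulr_ge0 // exprn_ge0.
  by rewrite gtr0_norm // fac_ge // leq_addr.
have r1 : r <= 1 by rewrite gerBl; apply: divr_ge0; [apply: mulr_ge0|]; exact: ltW.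
move=> k Kk.
have lowk : `|y K iN 0| * r ^+ k <= `|y k iN 0|.
  apply: le_trans (_ : `|y K iN 0| * r ^+ (k - K) <= _); last first.
    by have := low (k - K)%N; rewrite subnKC.
  by rewrite ler_wpM2l // ler_wiXn2l // leq_subr.
have P2 := moment1_iter lam_gt0 k x; rewrite -/(y k) -/S in P2.
have ly : l * y k iN 0 ^+ 2 <= moment lam 1 (y k).
  rewrite /moment (bigD1 iN) //= expr1 lerDl; apply: sumr_ge0 => j _.
  by rewrite mulr_ge0 ?sqr_ge0 ?expr1 // ltW.
rewrite mulrAC; apply: (@le_trans _ _ (`|y k iN 0| * Num.sqrt (l / S))).
  by rewrite ler_wpM2r ?sqrtr_ge0.
have := prod_rho_ge0 lam k x; move: P2; set P := \prod_(j < k) _ => P2 P0.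
rewrite -[leRHS]ger0_norm // -[leRHS]sqrtr_sqr -sqrtr_sqr -sqrtrM ?sqr_ge0 //.
rewrite ler_wsqrtr // mulrA ler_pdivrMr // -P2 mulrC //.
Qed.

End Weights.

(** * Zero sets of polynomials are Lebesgue null *)

Section PolynomialFunctions.
Variable R : realType.
Notation TR := (measurableTypeR R).

Inductive polyfun n : (n.-tuple TR -> R) -> Prop :=
| polyfun_cst c : polyfun (fun=> c)
| polyfun_tnth i : polyfun (fun t => tnth t i)
| polyfunD f g : polyfun f -> polyfun g -> polyfun (fun t => f t + g t)
| polyfunM f g : polyfun f -> polyfun g -> polyfun (fun t => f t * g t).

Lemma eq_polyfun n (f g : n.-tuple TR -> R) : f =1 g -> polyfun f -> polyfun g.
Proof. by move=> /funext ->. Qed.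

Lemma polyfun_sum n (I : Type) (s : seq I) (P : pred I)
    (f : I -> n.-tuple TR -> R) :
  (forall i, polyfun (f i)) -> polyfun (fun t => \sum_(i <- s | P i) f i t).
Proof.
move=> pf; elim: s => [|a s IH].
  by apply: eq_polyfun (polyfun_cst n 0) => t; rewrite big_nil.
have [Pa|Pa] := boolP (P a).
  by apply: eq_polyfun (polyfunD (pf a) IH) => t; rewrite big_cons Pa.
by apply: eq_polyfun IH => t; rewrite big_cons (negbTE Pa).
Qed.

Lemma polyfunX n (f : n.-tuple TR -> R) k : polyfun f -> polyfun (fun t => f t ^+ k).
Proof.
move=> pf; elim: k => [|k IH].
  by apply: eq_polyfun (polyfun_cst n 1) => t; rewrite expr0.
by apply: eq_polyfun (polyfunM pf IH) => t; rewrite exprS.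
Qed.

Lemma measurable_polyfun n (f : n.-tuple TR -> R) :
  polyfun f -> measurable_fun setT f.
Proof.
elim=> [c|i|g h _ mg _ mh|g h _ mg _ mh].
- exact: measurable_cst.
- exact: measurable_tnth.
- exact: measurable_funD.
- exact: measurable_funM.
Qed.

Lemma measurable_polyfun_eq n (f : n.-tuple TR -> R) c :
  polyfun f -> measurable [set t | f t = c].
Proof.
move=> /measurable_polyfun mf.
rewrite (_ : [set t | f t = c] = setT `&` f @^-1` [set c]); last by rewrite setTI.
exact: mf.
Qed.

Lemma polyfun_tcons n (f : n.+1.-tuple TR -> R) : polyfun f ->
  exists P : n.-tuple TR -> {poly R},
    (forall j, polyfun (fun t => (P t)`_j)) /\
    forall p, f (tcons p) = (P p.2).[p.1].
Proof.
elim=> [c|i|g h _ [P [cP eP]] _ [Q [cQ eQ]]|g h _ [P [cP eP]] _ [Q [cQ eQ]]].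
- exists (fun=> c%:P); split=> [j|p]; first exact: polyfun_cst.
  by rewrite hornerC.
- case: (unliftP ord0 i) => [j ->|->].
    exists (fun t => (tnth t j : R)%:P); split=> [k|p]; last by rewrite hornerC tnthS.
    case: k => [|k].
      by apply: eq_polyfun (polyfun_tnth j) => t; rewrite coefC.
    by apply: eq_polyfun (polyfun_cst n 0) => t; rewrite coefC.
  exists (fun=> 'X); split=> [j|p]; first exact: polyfun_cst.
  by rewrite hornerX.
- exists (fun t => P t + Q t); split=> [j|p]; last by rewrite hornerD -eP -eQ.
  by apply: eq_polyfun (polyfunD (cP j) (cQ j)) => t; rewrite coefD.
- exists (fun t => P t * Q t); split=> [j|p]; last by rewrite hornerM -eP -eQ.
  apply: eq_polyfun => [t|]; first by rewrite coefM.
  by apply: polyfun_sum => k; apply: polyfunM.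
Qed.

Lemma countable_roots (p : {poly R}) : p != 0 -> countable [set x | p.[x] = 0].
Proof.
move=> p0; suff [s sP] : exists s : seq R, forall x, root p x -> x \in s.
  apply: (@sub_countable _ _ _ [set` s]).
    by apply: subset_card_le => x /= /rootP /sP.
  exact: finite_set_countable.
have [m] := ubnP (size p); elim: m p p0 => // m IH p p0 pm.
have [[a pa]|np] := pselect (exists a, root p a); last first.
  by exists [::] => x px; case: np; exists x.
have [q pq] := factor_theorem p a pa.
have q0 : q != 0 by apply: contraNneq p0 => q0; rewrite pq q0 mul0r.
have [|s sP] := IH q q0.
  by move: pm; rewrite pq size_Mmonic ?monicXsubC // size_XsubC addn2.
exists (a :: s) => x; rewrite pq rootM root_XsubC inE => /orP[/sP ->|->] //.
by rewrite orbT.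
Qed.

(** By induction on n: some coefficient with respect to the first variable is a
nonzero polynomial in the others. Off its null set of zeros the sections of the
zero set are finite, so Fubini applies. *)
Theorem polyfun_zeros_null n (f : n.-tuple TR -> R) t0 :
  polyfun f -> f t0 != 0 -> lebesgue_tuple R n [set t | f t = 0] = 0%E.
Proof.
elim: n f t0 => [|n IH] f t0 pf f0.
  rewrite (_ : [set t | f t = 0] = set0) ?measure0 //.
  by apply/seteqP; split => // t /= ft; move: f0; rewrite (tuple0 t0) -(tuple0 t) ft eqxx.
have [P [cP eP]] := polyfun_tcons pf.
have mf := measurable_polyfun_eq 0 pf.
have [j cj0] : exists j, (P (tuncons t0).2)`_j != 0.
  apply: contrapT => nj.
  have Pt0 : P (tuncons t0).2 = 0.
    apply/polyP => j; rewrite coef0; apply/eqP; apply: contrapT => cj.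
    by apply: nj; exists j; apply/negP.
  by move: f0; rewrite -(tunconsK t0) eP Pt0 horner0 eqxx.
(* The zero set B splits into its part above N, and a part whose sections in the
   first variable are countable. *)
pose N := [set t | (P t)`_j = 0].
have mN : measurable N by exact: measurable_polyfun_eq.
have N0 : lebesgue_tuple R n N = 0%E by exact: IH cj0.
pose B := @tcons R n @^-1` [set t | f t = 0].
have mB : measurable B.
  rewrite -[B]setTI; apply: measurable_tcons => //.
pose m1 := @lebesgue_measure R; pose m2 := lebesgue_tuple R n.
change ((m1 \x m2)%E B = 0%E).
have mTN : measurable (setT `*` N : set (TR * n.-tuple TR)) by exact: measurableX.
have TN0 : (m1 \x m2)%E (setT `*` N) = 0%E.
  by rewrite product_measure1E // [X in (_ * X)%E]N0 mule0.
have mBN : measurable (B `\` (setT `*` N)) by exact: measurableD.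
have BN0 : (m1 \x m2)%E (B `\` (setT `*` N)) = 0%E.
  rewrite (@product_measure_unique _ _ _ _ _ m1 m2 (m1 \x^ m2)%E) //; last first.
    by move=> *; exact: product_measure2E.
  rewrite /product_measure2; apply: integral0_eq => t _ /=.
  apply: countable_lebesgue_measure0.
  have [tN|tN] := pselect (N t).
    rewrite (_ : ysection _ _ = set0) //.
    apply/seteqP; split => // x; rewrite /ysection /= inE => -[_].
    by case.
  have Pt : P t != 0 by apply/eqP => Pt; apply: tN; rewrite /N /= Pt coef0.
  apply: sub_countable (countable_roots Pt); apply: subset_card_le => x.
  rewrite /ysection /= inE => -[Bx _]; have := eP (x, t).
  by rewrite -[LHS]/(f (tcons (x, t))) Bx.
apply: (@subset_measure0 _ _ _ _ B ((setT `*` N) `|` (B `\` (setT `*` N)))) => //.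
- exact: measurableU.
- by move=> p Bp; have [|] := pselect ((setT `*` N) p); [left|right].
- exact: (null_set_setU mTN mBN TN0 BN0).
Qed.

Lemma polyfun_coord n i : polyfun (fun t : n.-tuple TR => cvec t i 0).
Proof. by apply: eq_polyfun (@polyfun_tnth n i) => t; rewrite mxE. Qed.

Lemma coord_null n i : lebesgue_tuple R n [set t | cvec t i 0 = 0] = 0%E.
Proof.
apply: (polyfun_zeros_null (t0 := [tuple 1 | _ < n]) (polyfun_coord i)).
by rewrite mxE tnth_mktuple oner_neq0.
Qed.

End PolynomialFunctions.

(** * Generic starting points *)

Section Generic.
Variables (R : realType) (n : nat) (lam : 'rV[R]_n).
Hypothesis lam_gt0 : forall i, 0 < lam 0 i.
Implicit Types x : 'cV[R]_n.
Notation TR := (measurableTypeR R).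

(** Gradient descent with its denominator cleared. By homogeneity its iterates are
multiples of those of gradient descent, so that a vanishing coordinate of the
latter forces one of the former. *)
Definition polyGD x : 'cV[R]_n :=
  \col_i (x i 0 * (moment lam 3 x - moment lam 2 x * lam 0 i)).

Lemma polyGD_OGD x : polyGD x = moment lam 3 x *: OGD lam x.
Proof.
have [->|x0] := eqVneq x 0.
  by apply/colP => i; rewrite /OGD eqxx !mxE mul0r mulr0.
have m3 := moment_gt0 lam_gt0 3 x0.
by apply/colP => i; rewrite !mxE OGDE; field; rewrite gt_eqF.
Qed.

Lemma polyGDZ c x : polyGD (c *: x) = c ^+ 3 *: polyGD x.
Proof. by apply/colP => i; rewrite !mxE !momentZ; ring. Qed.

Lemma polyGD_iterZ k c x : iter k polyGD (c *: x) = c ^+ (3 ^ k) *: iter k polyGD x.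
Proof.
elim: k => [|k IH]; first by rewrite expr1.
by rewrite !iterS IH polyGDZ -exprM expnSr.
Qed.

Lemma polyGD_iter k x : exists c, iter k polyGD x = c *: iter k (OGD lam) x.
Proof.
elim: k => [|k [c IH]]; first by exists 1; rewrite scale1r.
exists (c ^+ 3 * moment lam 3 (iter k (OGD lam) x)).
by rewrite !iterS IH polyGDZ polyGD_OGD scalerA.
Qed.

Lemma polyfun_moment k (y : n.-tuple TR -> 'cV[R]_n) :
  (forall i, polyfun (fun t => y t i 0)) -> polyfun (fun t => moment lam k (y t)).
Proof.
move=> py; apply: polyfun_sum => i.
by apply: polyfunM; [exact: polyfun_cst | exact: polyfunX].
Qed.

(** The factor by which polyGD multiplies the i-th coordinate. *)
Let growth i (y : 'cV[R]_n) := moment lam 3 y - moment lam 2 y * lam 0 i.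

Lemma polyfun_growth i (y : n.-tuple TR -> 'cV[R]_n) :
  (forall j, polyfun (fun t => y t j 0)) -> polyfun (fun t => growth i (y t)).
Proof.
move=> py.
apply: eq_polyfun (polyfunD (polyfun_moment 3 py)
  (polyfunM (polyfun_moment 2 py) (polyfun_cst n (- lam 0 i)))) => t.
by rewrite /growth; ring.
Qed.

Lemma polyfun_polyGD_iter k i : polyfun (fun t => iter k polyGD (cvec t) i 0).
Proof.
elim: k i => [|k IH] i.
  exact: polyfun_coord.
have pg := polyfun_growth (y := fun t => iter k polyGD (cvec t)) i IH.
by apply: eq_polyfun (polyfunM (IH i) pg) => t; rewrite iterS mxE.
Qed.

(** On vectors carried by the two extreme coordinates, with squared gradient
entries U and W there, the growth factor of i is
(L - lambda_i) U - (lambda_i - l) W, and a step exchanges U and W up to a common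
factor. So it is enough that this expression is nonzero for (U, W) and for
(W, U). *)
Lemma growth_witness (i0 iN i : 'I_n) :
  lam 0 iN < lam 0 i -> lam 0 i < lam 0 i0 ->
  exists x, forall k, growth i (iter k polyGD x) != 0.
Proof.
set L := lam 0 i0; set l := lam 0 iN => li iL.
have i0N : i0 != iN.
  by apply/eqP => e; move: (lt_trans li iL); rewrite /l /L e ltxx.
pose b := L - lam 0 i; pose c := lam 0 i - l.
have b0 : 0 < b by rewrite /b subr_gt0.
have c0 : 0 < c by rewrite /c subr_gt0.
have L0 : 0 < L by exact: lam_gt0.
have l0 : 0 < l by exact: lam_gt0.
pose U y := L ^+ 2 * (y : 'cV[R]_n) i0 0 ^+ 2.
pose W y := l ^+ 2 * (y : 'cV[R]_n) iN 0 ^+ 2.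
pose good y := [/\ on_ends i0 iN y, U y != 0, W y != 0,
  b * U y != c * W y & b * W y != c * U y].
have m2E y : good y -> moment lam 2 y = U y + W y.
  by move=> [ey _ _ _ _]; rewrite (@moment_on_ends _ _ _ i0 iN).
have m3E y : good y -> moment lam 3 y = L * U y + l * W y.
  move=> [ey _ _ _ _]; rewrite (@moment_on_ends _ _ _ i0 iN) // /U /W -/L -/l.
  ring.
have step y : good y -> good (polyGD y).
  move=> gy; have m2 := m2E y gy; have m3 := m3E y gy.
  have [ey U0 W0 UW WU] := gy.
  pose s := U y * W y * (L - l) ^+ 2.
  have Ll : L - l != 0 by rewrite subr_eq0 gt_eqF // (lt_trans li).
  have s0 : s != 0 by rewrite /s mulf_neq0 ?expf_neq0 // mulf_neq0.
  have UE : U (polyGD y) = s * W y.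
    have e : polyGD y i0 0 = y i0 0 * (W y * (l - L)).
      by rewrite mxE m2 m3 -/L; ring.
    transitivity (U y * (W y * (l - L)) ^+ 2); first by rewrite [LHS]/U e exprMn mulrA.
    by rewrite /s; ring.
  have WE : W (polyGD y) = s * U y.
    have e : polyGD y iN 0 = y iN 0 * (U y * (L - l)).
      by rewrite mxE m2 m3 -/l; ring.
    transitivity (W y * (U y * (L - l)) ^+ 2); first by rewrite [LHS]/W e exprMn mulrA.
    by rewrite /s; ring.
  split; rewrite ?UE ?WE.
  - by move=> j h1 h2; rewrite mxE ey // mul0r.
  - exact: mulf_neq0.
  - exact: mulf_neq0.
  - by rewrite ![_ * (s * _)]mulrCA (inj_eq (mulfI s0)).
  - by rewrite ![_ * (s * _)]mulrCA (inj_eq (mulfI s0)).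
have good_growth y : good y -> growth i y != 0.
  move=> gy; rewrite /growth m2E // m3E //; have [_ _ _ UW _] := gy.
  have -> : L * U y + l * W y - (U y + W y) * lam 0 i = b * U y - c * W y.
    by rewrite /b /c; ring.
  by rewrite subr_eq0.
(* With U = 1 and W = tau^2 both conditions hold as soon as tau^2 exceeds b / c
   and c / b. *)
pose tau := b / c + c / b + 1.
pose x : 'cV[R]_n := \col_j (if j == i0 then L^-1 else if j == iN then tau / l else 0).
have bc : 0 < b / c by rewrite divr_gt0.
have cb : 0 < c / b by rewrite divr_gt0.
have tau1 : 1 < tau by rewrite /tau; lra.
have tau2 : tau < tau ^+ 2 by rewrite expr2 ltr_pMl // (lt_trans _ tau1).
have Ux : U x = 1 by rewrite /U mxE eqxx; field; rewrite gt_eqF.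
have Wx : W x = tau ^+ 2.
  by rewrite /W mxE eq_sym (negbTE i0N) eqxx; field; rewrite gt_eqF.
exists x => k; apply: good_growth.
elim: k => [|k IH]; last exact: step.
split; rewrite ?Ux ?Wx ?oner_eq0 //.
- by move=> j h1 h2; rewrite mxE (negbTE h1) (negbTE h2).
- by rewrite expf_neq0 // gt_eqF // (lt_trans _ tau1).
- rewrite mulr1 mulrC lt_eqF // -ltr_pdivrMr //.
  by apply: lt_trans tau2; rewrite /tau; lra.
- rewrite mulr1 mulrC gt_eqF // -ltr_pdivrMr //.
  by apply: lt_trans tau2; rewrite /tau; lra.
Qed.

Lemma cvec_tuple x : exists t : n.-tuple TR, cvec t = x.
Proof.
exists [tuple (x i 0 : TR) | i < n]; apply/colP => i.
by rewrite mxE tnth_mktuple.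
Qed.

(** The i-th coordinate of the k-th iterate is the product of the starting
coordinate and of the k growth factors, each of which is a polynomial that is
nonzero somewhere. *)
Theorem polyGD_iter_null (i0 iN i : 'I_n) k :
  lam 0 iN < lam 0 i -> lam 0 i < lam 0 i0 ->
  lebesgue_tuple R n [set t | iter k polyGD (cvec t) i 0 = 0] = 0%E.
Proof.
move=> li iL; have [x xg] := growth_witness li iL.
have [tx txE] := cvec_tuple x.
elim: k => [|k IH]; first exact: coord_null.
have pg := polyfun_growth (y := fun t => iter k polyGD (cvec t)) i (polyfun_polyGD_iter k).
have g0 : lebesgue_tuple R n [set t | growth i (iter k polyGD (cvec t)) = 0] = 0%E.
  by apply: (polyfun_zeros_null (t0 := tx) pg); rewrite txE.
have mA := measurable_polyfun_eq 0 (polyfun_polyGD_iter k i).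
have mB := measurable_polyfun_eq 0 pg.
apply: subset_measure0 (null_set_setU mA mB IH g0) => //.
- exact: measurable_polyfun_eq (polyfun_polyGD_iter k.+1 i).
- exact: measurableU.
move=> t /=; rewrite mxE => /eqP; rewrite mulf_eq0 => /orP[|] /eqP.
  by left.
by right.
Qed.

End Generic.

(** * Averages over the sphere *)

Section ProbabilityBounds.
Context d (T : measurableType d) (R : realType) (mu : probability T R).
Variables (D : set T) (f : T -> R).
Hypothesis mD : measurable D.
Hypothesis muD : mu D = 1%E.
Hypothesis f01 : forall t, D t -> 0 <= f t <= 1.

(** The integral of a nonnegative function is a supremum over the simple functions
below it, so monotonicity holds for arbitrary functions, here the rate of
convergence. *)
Lemma ge0_integral_mono (g h : T -> \bar R) :
  (forall t, D t -> 0 <= g t)%E -> (forall t, D t -> g t <= h t)%E ->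
  (\int[mu]_(t in D) g t <= \int[mu]_(t in D) h t)%E.
Proof.
move=> g0 gh; rewrite !ge0_integralE //; last first.
  by move=> t Dt; apply: le_trans (gh t Dt); exact: g0.
apply: le_ereal_sup => _ [s /= sg <-]; exists s => // t.
apply: le_trans (sg t) _; rewrite !patchE; case: ifPn => // tD.
by apply: gh; rewrite -inE.
Qed.

Let f0 t : D t -> (0 <= (f t)%:E)%E.
Proof. by move=> /f01 /andP[? _]; rewrite lee_fin. Qed.

Let int_ge0 : (0 <= \int[mu]_(t in D) (f t)%:E)%E.
Proof. exact: integral_ge0. Qed.

Let int_le1 : (\int[mu]_(t in D) (f t)%:E <= 1)%E.
Proof.
apply: (@le_trans _ _ (\int[mu]_(t in D) (cst 1%E t))%E).
  by apply: ge0_integral_mono => // t /f01 /andP[_ ?]; rewrite lee_fin.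
by rewrite integral_cst // mul1e probability_le1.
Qed.

Let int_fin : (\int[mu]_(t in D) (f t)%:E)%E \is a fin_num.
Proof. by rewrite ge0_fin_numE // (le_lt_trans int_le1) // ltry. Qed.

Lemma Rintegral_prob01 : 0 <= \int[mu]_(t in D) f t <= 1.
Proof.
apply/andP; split; first exact: fine_ge0.
by rewrite /Rintegral -lee_fin fineK.
Qed.

Lemma Rintegral_prob_le (A : set T) (b : R) : measurable A -> 0 <= b ->
  (forall t, D t -> ~ A t -> f t <= b) ->
  \int[mu]_(t in D) f t <= b + fine (mu A).
Proof.
move=> mA b0 fb; rewrite /Rintegral -lee_fin fineK // EFinD fineK ?fin_num_measure //.
apply: (@le_trans _ _ (\int[mu]_(t in D) (cst b%:E t + (\1_A t)%:E))%E).
  apply: ge0_integral_mono => // t Dt; have /andP[_ f1] := f01 Dt.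
  rewrite /cst -EFinD lee_fin indicE; have [tA|tA] := pselect (A t).
    by rewrite mem_set // (le_trans f1) // lerDr.
  by rewrite memNset // addr0; exact: fb.
rewrite ge0_integralD //.
  rewrite integral_cst // [X in (_ * X + _)%E]muD mule1 integral_indic // leeD2l //.
  by apply: le_measure; rewrite ?inE //; exact: measurableI.
by apply/measurable_EFinP; exact: measurable_indic.
Qed.

Lemma Rintegral_prob_ge (A : set T) (b : R) : measurable A -> mu A = 0%E -> 0 <= b ->
  (forall t, D t -> ~ A t -> b <= f t) -> b <= \int[mu]_(t in D) f t.
Proof.
move=> mA A0 b0 fb; rewrite /Rintegral -lee_fin fineK //.
apply: (@le_trans _ _ (\int[mu]_(t in D) (b * \1_(~` A) t)%:E)%E); last first.
  apply: ge0_integral_mono => t Dt; first by rewrite lee_fin mulr_ge0.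
  rewrite lee_fin indicE; have [tA|tA] := pselect (A t).
    by rewrite memNset ?mulr0 //; case/andP: (f01 Dt).
  by rewrite mem_set // mulr1; exact: fb.
rewrite (@integralZl_indic _ _ _ _ _ _ (fun=> ~` A)) //; last exact: measurableC.
- rewrite integral_indic //; last exact: measurableC.
  have mAD : measurable (~` A `&` D) by apply: measurableI => //; exact: measurableC.
  suff muAD : mu (~` A `&` D) = 1%E by rewrite [X in (_ * X)%E]muAD mule1.
  apply/eqP; rewrite eq_le probability_le1 //= -muD.
  apply: (@le_trans _ _ (mu ((~` A `&` D) `|` A))).
    apply: le_measure; rewrite ?inE //; first exact: measurableU.
    by move=> t Dt; have [tA|tA] := pselect (A t); [right | left].
  apply: (@le_trans _ _ (mu (~` A `&` D) + mu A)%E); first exact: measureU2.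
  by rewrite A0 adde0.
- by move=> b_lt0; move: (le_lt_trans b0 b_lt0); rewrite ltxx.
Qed.

End ProbabilityBounds.

Section SphereNull.
Variables (R : realType) (n : nat).
Notation TR := (measurableTypeR R).

Lemma cvec_tnormalize (t : n.-tuple TR) :
  cvec (tnormalize t) = (tnorm t)^-1 *: cvec t.
Proof. by apply/colP => i; rewrite !mxE tnth_mktuple mulrC. Qed.

Lemma tnorm_eq0 (t : n.-tuple TR) : tnorm t = 0 -> cvec t = 0.
Proof.
have one_gt0 i : 0 < (const_mx 1 : 'rV[R]_n) 0 i by rewrite mxE.
move=> t0; have [//|ct0] := eqVneq (cvec t) 0.
have := moment_gt0 one_gt0 0 ct0.
by rewrite -qform1_moment0 -sqrtr_gt0 -/(tnorm t) t0 ltxx.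
Qed.

(** The uniform measure of the sphere is the image of the uniform law on the ball
under normalization, and N contains its own preimage. *)
Lemma uniform_sphere_null (N : set (n.-tuple TR)) : measurable N ->
  lebesgue_tuple R n N = 0%E -> (forall t, N (tnormalize t) -> N t) ->
  @uniform_sphere R n N = 0%E.
Proof.
move=> mN N0 cone.
rewrite uniform_sphereE (@subset_measure0 _ _ _ (lebesgue_tuple R n) _ N) ?mul0e //.
  apply: measurableI; last exact: measurable_tball.
  by rewrite -[X in measurable X]setTI; apply: measurable_tnormalize.
by move=> t [/cone].
Qed.

Lemma uniform_sphere_coord0 (i : 'I_n) :
  @uniform_sphere R n [set t | cvec t i 0 = 0] = 0%E.
Proof.
apply: uniform_sphere_null.
- exact: measurable_polyfun_eq (@polyfun_coord R n i).
- exact: coord_null.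
move=> t /=; rewrite cvec_tnormalize mxE => /eqP; rewrite mulf_eq0 invr_eq0.
by move=> /orP[/eqP /tnorm_eq0 ->|/eqP //]; rewrite mxE.
Qed.

Lemma measurable_coord_le (i : 'I_n) (c : R) :
  measurable [set t : n.-tuple TR | `|cvec t i 0| <= c].
Proof.
rewrite (_ : [set t | _] = setT `&` (fun t => `|tnth t i : R|) @^-1` `]-oo, c]).
  apply: measurableT_comp => //; exact: measurable_tnth.
by apply/seteqP; split => t; rewrite /= in_itv /= mxE => // -[].
Qed.

(** Continuity from above of the measure: the slabs decrease to a hyperplane. *)
Lemma uniform_sphere_coord_small (i : 'I_n) (e : R) : 0 < e ->
  exists2 c : R, 0 < c &
    fine (@uniform_sphere R n [set t | `|cvec t i 0| <= c]) < e.
Proof.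
move=> e0.
pose F k : set (n.-tuple TR) := [set t | `|cvec t i 0| <= k.+1%:R^-1].
have mF k : measurable (F k) by exact: measurable_coord_le.
have F0 : \bigcap_k F k = [set t | cvec t i 0 = 0].
  apply/seteqP; split => t /=; last by move=> t0 k _; rewrite /F /= t0 normr0.
  move=> tF; apply/eqP; rewrite -normr_le0 leNgt; apply/negP => t_gt0.
  have := tF (Num.truncn (`|cvec t i 0|^-1)) I; rewrite /F /=; apply/negP; rewrite -ltNge.
  by rewrite -[ltRHS]invrK ltf_pV2 ?posrE ?invr_gt0 // truncnS_gt.
have cvF : (fine \o (@uniform_sphere R n \o F)) k @[k --> \oo] --> 0%R.
  have : (@uniform_sphere R n \o F) k @[k --> \oo] -->
      @uniform_sphere R n (\bigcap_k F k); last first.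
    by rewrite F0 uniform_sphere_coord0 => /fine_cvg.
  apply: nonincreasing_cvg_mu => //.
  - by rewrite (le_lt_trans (probability_le1 _ _)) ?ltry.
  - exact: bigcapT_measurable.
  - apply/nonincreasing_seqP => k; apply/subsetPset => t; rewrite /F /=.
    by move=> /le_trans; apply; rewrite lef_pV2 ?posrE // ler_nat.
have /cvgrPdist_lt /(_ _ e0) [K _ KH] := cvF.
exists K.+1%:R^-1; first by rewrite invr_gt0.
have := KH K (leqnn K); rewrite /= sub0r normrN; apply: le_lt_trans.
exact: ler_norm.
Qed.

Lemma uniform_sphere_polyGD (lam : 'rV[R]_n) (i0 iN i : 'I_n) k :
  (forall j, 0 < lam 0 j) -> lam 0 iN < lam 0 i -> lam 0 i < lam 0 i0 ->
  @uniform_sphere R n [set t | iter k (polyGD lam) (cvec t) i 0 = 0] = 0%E.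
Proof.
move=> lam_gt0 li iL.
apply: uniform_sphere_null.
- exact: measurable_polyfun_eq (polyfun_polyGD_iter _ _ _).
- exact: polyGD_iter_null li iL.
move=> t /=; rewrite cvec_tnormalize polyGD_iterZ mxE => /eqP.
rewrite mulf_eq0 expf_eq0 invr_eq0 => /orP[/andP[_ /eqP /tnorm_eq0 ->]|/eqP //].
have := polyGD_iterZ lam k 0 0; rewrite scale0r => ->.
by rewrite expr0n expn_eq0 /= scale0r mxE.
Qed.

Lemma measurable_sphere : measurable (@cvec R n @^-1` @sphere R n).
Proof.
rewrite (_ : _ @^-1` _ = [set t | \sum_(i < n) (tnth t i : R) ^+ 2 = 1]).
  apply: measurable_polyfun_eq; apply: polyfun_sum => i.
  by apply: polyfunX; exact: polyfun_tnth.
by apply/seteqP; split => t; rewrite /sphere /= qform1E.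
Qed.

End SphereNull.

Section Average.
Variables (R : realType) (n : nat) (lam : 'rV[R]_n.+1).
Hypothesis slam : spectrum_vec lam.
Notation TR := (measurableTypeR R).
Let L := lam 0 ord0.
Let l := lam 0 ord_max.

Lemma spectrum_max i : lam 0 i <= L. Proof. exact: slam.1. Qed.

Lemma spectrum_min i : l <= lam 0 i.
Proof. by apply: slam.1; rewrite leq_ord. Qed.

Lemma spectrum_gt0 i : 0 < lam 0 i.
Proof. exact: lt_le_trans slam.2 (spectrum_min i). Qed.

Let ROC01 (t : n.+1.-tuple TR) : (@cvec R n.+1 @^-1` @sphere R n.+1) t ->
  0 <= ROC lam (cvec t) <= 1.
Proof.
move=> _; rewrite (ROC_ge0 spectrum_gt0) /=.
by apply: ROC_le => [|k]; [exact: spectrum_gt0 | exact: rho_le1 spectrum_gt0 _].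
Qed.

Let sphere1 : @uniform_sphere R n.+1 (@cvec R n.+1 @^-1` @sphere R n.+1) = 1%E.
Proof. exact: uniform_sphere_sphere. Qed.

Lemma aveROC01 : 0 <= aveROC lam <= 1.
Proof.
exact: (Rintegral_prob01 (@uniform_sphere R n.+1) (@measurable_sphere R n.+1) ROC01).
Qed.

(** Off the slab the bound of [ROC_two_eigenvalues] is uniform, and on the slab
the rate is at most 1. *)
Lemma aveROC_two_eigenvalues_le (delta : R) : 0 < delta ->
  (forall i, lam 0 i = L \/ lam 0 i = l) ->
  aveROC lam <= Num.sqrt (l / (L * delta ^+ 2)) +
    fine (@uniform_sphere R n.+1 [set t | `|cvec t ord0 0| <= delta]).
Proof.
move=> d0 two.
pose A : set (n.+1.-tuple TR) := [set t | `|cvec t ord0 0| <= delta].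
apply: (Rintegral_prob_le (mu := @uniform_sphere R n.+1) (A := A)
  (@measurable_sphere R n.+1) sphere1 ROC01).
- exact: measurable_coord_le.
- exact: sqrtr_ge0.
move=> t St /negP; rewrite -ltNge => td.
have t0 : cvec t ord0 0 != 0 by rewrite -normr_gt0 (lt_trans d0).
apply: le_trans (ROC_two_eigenvalues spectrum_gt0 spectrum_max two St t0) _.
rewrite ler_wsqrtr // -/L -/l.
have L0 : 0 < L by exact: spectrum_gt0.
have t2 : 0 < cvec t ord0 0 ^+ 2 by rewrite lt_neqAle sqr_ge0 andbT eq_sym sqrf_eq0.
have d2 : delta ^+ 2 <= cvec t ord0 0 ^+ 2.
  by rewrite -[leRHS]real_normK ?num_real // lerXn2r ?nnegrE // ltW.
apply: ler_wpM2l; first exact/ltW/spectrum_gt0.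
have Ld : 0 < L * delta ^+ 2 by rewrite mulr_gt0 ?exprn_gt0.
by rewrite lef_pV2 ?posrE ?ler_pM2l // mulr_gt0.
Qed.

(** The lower bound of [ROC_generic_ge] holds outside the null set of the points
with a zero extreme coordinate or whose i-th coordinate vanishes at some step. *)
Lemma aveROC_intermediate_ge (i : 'I_n.+1) (c : R) : l < lam 0 i -> lam 0 i < L ->
  0 < c -> 2 * c < (L - lam 0 i) * (lam 0 i - l) ->
  0 <= 1 - l * (L - l) / c -> 1 - l * (L - l) / c <= aveROC lam.
Proof.
move=> li iL c0 cw r0.
pose A k : set (n.+1.-tuple TR) := [set t | iter k (polyGD lam) (cvec t) i 0 = 0].
pose Z j : set (n.+1.-tuple TR) := [set t | cvec t j 0 = 0].
have mA k : measurable (A k) by exact: measurable_polyfun_eq (polyfun_polyGD_iter _ _ _).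
have mZ j : measurable (Z j).
  exact: measurable_polyfun_eq (@polyfun_coord R n.+1 j).
have ZN j : @uniform_sphere R n.+1 (Z j) = 0%E by exact: uniform_sphere_coord0.
have AN k : @uniform_sphere R n.+1 (A k) = 0%E.
  exact: (uniform_sphere_polyGD _ spectrum_gt0 li iL).
have mUA : measurable (\bigcup_k A k) by exact: bigcupT_measurable.
have UAN : @uniform_sphere R n.+1 (\bigcup_k A k) = 0%E.
  have [+ _] := negligibleP (@uniform_sphere R n.+1) mUA; apply.
  by apply: negligible_bigcup => k; apply/negligibleP; [exact: mA | exact: AN].
apply: (Rintegral_prob_ge (mu := @uniform_sphere R n.+1)
  (A := Z ord0 `|` Z ord_max `|` \bigcup_k A k)
  (@measurable_sphere R n.+1) sphere1 ROC01) => //.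
- by apply: measurableU => //; exact: measurableU.
- have ZZN := null_set_setU (mZ ord0) (mZ ord_max) (ZN _) (ZN _).
  by apply: (null_set_setU _ mUA ZZN UAN); exact: measurableU.
move=> t St nA.
have lL : l < L by exact: lt_trans li iL.
apply: (ROC_generic_ge spectrum_gt0 spectrum_max spectrum_min lL _ _ _ c0 cw r0).
- move=> k; apply/eqP => e; apply: nA; right; exists k => //.
  have [a aE] := polyGD_iter spectrum_gt0 k (cvec t).
  by rewrite /A /= aE mxE e mulr0.
- by apply/eqP => e; apply: nA; left; left.
- by apply/eqP => e; apply: nA; left; right.
Qed.

End Average.

(** * The limits *)

Section Limits.
Variables (R : realType) (n : nat).
Implicit Types lam : 'rV[R]_n.+1.

Lemma worstROC_cond lam : spectrum_vec lam ->
  worstROC lam = (1 - (cond lam)^-1) / (1 + (cond lam)^-1).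
Proof.
move=> slam; have lam_gt0 := spectrum_gt0 slam.
rewrite (worstROCE lam_gt0 (spectrum_max slam) (spectrum_min slam)) /cond.
have L0 := lam_gt0 ord0; have l0 := lam_gt0 ord_max.
by field; rewrite !gt_eqF ?addr_gt0.
Qed.

Lemma eigenvalue_diag_mx lam i : eigenvalue (diag_mx lam) (lam 0 i).
Proof.
apply/eigenvalueP; exists (delta_mx 0 i).
  apply/rowP => j; rewrite mul_mx_diag !mxE eqxx /=.
  by case: eqVneq => [->|_]; rewrite ?mulr0 ?mul0r // mulrC.
apply/eqP => /rowP /(_ i); rewrite !mxE !eqxx /= => /eqP.
by rewrite oner_eq0.
Qed.

Lemma two_eigenvalues_ends lam : two_eigenvalues lam ->
  lam 0 ord_max < lam 0 ord0 ->
  forall i, lam 0 i = lam 0 ord0 \/ lam 0 i = lam 0 ord_max.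
Proof.
move=> [a [b [_ ab]]] lL i.
have eig j : lam 0 j = a \/ lam 0 j = b.
  have := eigenvalue_diag_mx lam j; rewrite ab /= => /orP[] /eqP; by [left | right].
have : lam 0 ord_max <> lam 0 ord0 by apply/eqP; rewrite lt_eqF.
by case: (eig i) (eig ord0) (eig ord_max) => -> [] -> [] ->; tauto.
Qed.

(** The slab is chosen first: its measure does not depend on the eigenvalues. *)
Lemma aveROC_two_eigenvalues_cvg0 : cvg_cond (@two_eigenvalues R n) (@aveROC R n.+1) 0.
Proof.
move=> e e0; have e2 : 0 < e / 2 by rewrite divr_gt0.
have [d d0 dP] := @uniform_sphere_coord_small R n.+1 ord0 _ e2.
exists (2 + 4 / (d ^+ 2 * e ^+ 2)) => lam slam two condM.
have L0 := spectrum_gt0 slam ord0; have l0 := spectrum_gt0 slam ord_max.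
have de : 0 < d ^+ 2 * e ^+ 2 by rewrite mulr_gt0 ?exprn_gt0.
have k0 : 0 < 4 / (d ^+ 2 * e ^+ 2) by rewrite divr_gt0.
have lL : lam 0 ord_max < lam 0 ord0.
  rewrite -[ltLHS]mul1r -ltr_pdivlMr //; apply: lt_le_trans condM; lra.
have := aveROC_two_eigenvalues_le slam d0 (two_eigenvalues_ends two lL).
have /andP[a0 _] := aveROC01 slam.
rewrite subr0 ger0_norm // => /le_lt_trans; apply.
rewrite [ltRHS](splitr e); apply: ler_ltD => //.
rewrite -[leRHS]ger0_norm ?(ltW e2) // -sqrtr_sqr ler_wsqrtr //.
have : 4 / (d ^+ 2 * e ^+ 2) <= cond lam by apply: le_trans condM; rewrite lerDr.
rewrite /cond ler_pdivrMr // mulrAC ler_pdivlMr // => h.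
rewrite ler_pdivrMr ?mulr_gt0 ?exprn_gt0 // expr_div_n mulrAC ler_pdivlMr ?exprn_gt0 //.
by move: h; rewrite -(ler_pM2r (ltr0Sn R 3)) => h; lra.
Qed.

(** Both rates are within e of 1, from which their difference is small too. *)
Lemma aveROC_worstROC_intermediate (eta e : R) : 0 < eta -> eta < 1 / 2 -> 0 < e ->
  exists M : R, forall lam, spectrum_vec lam -> intermediate eta lam -> M <= cond lam ->
    (1 - e < aveROC lam <= 1) /\ (1 - e < worstROC lam <= 1).
Proof.
move=> eta0 eta2 e0.
have eta2_gt0 : 0 < eta ^+ 2 by rewrite exprn_gt0.
exists (2 + 4 / eta ^+ 2 * (1 + e^-1)) => lam slam [lL [i [_ li iL]]].
set L := lam 0 ord0 in lL li iL *; set l := lam 0 ord_max in lL li iL *.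
have l0 : 0 < l by exact: (spectrum_gt0 slam).
have L0 : 0 < L by exact: (spectrum_gt0 slam).
have D0 : 0 < L - l by rewrite subr_gt0.
have ei0 : 0 < e^-1 by rewrite invr_gt0.
have b16 : 4 <= 4 / eta ^+ 2.
  rewrite ler_pdivlMr // ler_piMr // expr_le1 ?ltW //; lra.
move: b16; set B := 4 / eta ^+ 2 => b16.
rewrite /cond -/L -/l ler_pdivlMr // => condM.
have lDB : l * (B * (1 + e^-1)) <= L - l by nra.
have B0 : 0 < B by lra.
have eK : e * e^-1 = 1 by rewrite divff // gt_eqF.
have lBe : l * B / (L - l) < e.
  rewrite ltr_pdivrMr //; apply: lt_le_trans (_ : e * (l * (B * (1 + e^-1))) <= _).
    have -> : e * (l * (B * (1 + e^-1))) = l * B * e + l * B * (e * e^-1) by ring.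
    by rewrite eK mulr1 ltrDr mulr_gt0 // mulr_gt0.
  by rewrite ler_pM2l.
have lB1 : l * B / (L - l) <= 1.
  rewrite ler_pdivrMr // mul1r; apply: le_trans lDB.
  have -> : l * (B * (1 + e^-1)) = l * B + l * B * e^-1 by ring.
  rewrite lerDl; apply: mulr_ge0; last exact: ltW.
  by apply: mulr_ge0; exact: ltW.
(* The intermediate eigenvalue makes (L - lambda_i) (lambda_i - l) at least
   eta^2 (L - l)^2, which is more than 2 c. *)
pose c := eta ^+ 2 * (L - l) ^+ 2 / 4.
have c0 : 0 < c by rewrite divr_gt0 ?mulr_gt0 ?exprn_gt0.
have cE : l * (L - l) / c = l * B / (L - l).
  by rewrite /c /B; field; rewrite !gt_eqF.
have eD : 0 < eta * (L - l) by rewrite mulr_gt0.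
have h1 : eta * (L - l) <= lam 0 i - l by lra.
have h2 : eta * (L - l) <= L - lam 0 i by lra.
have ave : 1 - l * (L - l) / c <= aveROC lam.
  apply: (@aveROC_intermediate_ge _ _ _ slam i) => //;
    rewrite -/L -/l ?cE ?subr_ge0 //; try lra.
  apply: (@lt_le_trans _ _ ((eta * (L - l)) * (eta * (L - l)))).
    by rewrite /c; nra.
  by apply: ler_pM => //; exact: ltW.
split.
  have /andP[_ ->] := aveROC01 slam; rewrite andbT.
  by apply: lt_le_trans ave; rewrite cE; lra.
rewrite (worstROCE (spectrum_gt0 slam) (spectrum_max slam) (spectrum_min slam)) -/L -/l.
have LlD : 0 < L + l by rewrite addr_gt0.
rewrite ltr_pdivlMr // ler_pdivrMr //; apply/andP; split; last by lra.
have h : 4 * l <= l * B by rewrite mulrC ler_pM2l.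
move: lBe; rewrite ltr_pdivrMr // => lBe.
have : 0 < e * l by rewrite mulr_gt0.
lra.
Qed.

End Limits.

Theorem theorem1p2 (R : realType) (n : nat) :
  (* WorstROC(lambda) = (1 - a) / (1 + a), in every dimension n.+1 *)
  [/\ (forall lam : 'rV[R]_n.+1, spectrum_vec lam ->
        worstROC lam = (1 - (cond lam)^-1) / (1 + (cond lam)^-1)),
  (* (i) *)
      ((2 <= n.+1)%N ->
        cvg_cond (@two_eigenvalues R n) (@aveROC R n.+1) 0)
  (* (ii) *)
    & ((3 <= n.+1)%N -> forall eta : R, 0 < eta -> eta < 1 / 2 ->
        cvg_cond (@intermediate R n eta)
          (fun lam : 'rV[R]_n.+1 => worstROC lam - aveROC lam) 0 /\
        cvg_cond (@intermediate R n eta) (@worstROC R n.+1) 1)].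
Proof.
split; [exact: worstROC_cond | by move=> _; exact: aveROC_two_eigenvalues_cvg0 |].
move=> _ eta eta0 eta2; split=> e e0;
  have [M HM] := aveROC_worstROC_intermediate n eta0 eta2 e0;
  exists M => lam slam ilam condM;
  have [/andP[a1 a2] /andP[w1 w2]] := HM lam slam ilam condM;
  rewrite ltr_norml; lra.
Qed.
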